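(* For every fixed integer $k \ge 1$, the propositional formulas $\mathrm{Kneser}^n_k$ ($n \ge 2k$) have Frege proofs of size quasi-polynomial in $n$.
   Context: Notation: $[n]=\{1,\dots,n\}$, and $\binom{n}{k}$ is identified with the set of $k$-element subsets of $[n]$ (the vertices of the $(n,k)$-Kneser graph, in which two vertices are adjacent iff they are disjoint). Let $n \ge 2k > 1$ and $m = n-2k+1$. For $S \in \binom{n}{k}$ and $i \in [m]$ let $p_{S,i}$ be a propositional variable (intended meaning: vertex $S$ is assigned color $i$). The formula $\mathrm{Kneser}^n_k$ is $$\bigwedge_{S \in \binom{n}{k}} \bigvee_{i\in[m]} p_{S,i} \;\rightarrow\; \bigvee_{\substack{S,T\in\binom{n}{k}\\ S\cap T=\emptyset}} \bigvee_{i\in[m]} (p_{S,i}\wedge p_{T,i}).$$ A Frege system is a sound and (implicationally) complete proof system for propositional logic with finitely many axiom schemes and inference rules (e.g. a textbook system whose only rule is modus ponens; all such systems are polynomially equivalent). The size of a proof is the number of symbols in it. ''Size quasi-polynomial in $n$'' means: for each fixed $k$ there is a constant $C_k$ such that for every $n\ge 2k$ there is a Frege proof of $\mathrm{Kneser}^n_k$ of size at most $2^{C_k(\log n)^{C_k}}$. *)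

(* Defs.v *)
From HB Require Import structures.
From mathcomp Require Import all_boot.

Set Implicit Arguments.
Unset Strict Implicit.
Unset Printing Implicit Defensive.

(* Propositional formulas over an arbitrary type V of variables. *)
Inductive form (V : Type) : Type :=
| Var of V
| Top
| Bot
| Neg of form V
| And of form V & form V
| Or of form V & form V
| Imp of form V & form V.

Arguments Top {V}.
Arguments Bot {V}.

Section FormEqType.
Variable V : eqType.

Fixpoint form_encode (f : form V) : GenTree.tree V :=
  match f with
  | Var x => GenTree.Leaf x
  | Top => GenTree.Node 0 [::]
  | Bot => GenTree.Node 1 [::]
  | Neg g => GenTree.Node 2 [:: form_encode g]
  | And g h => GenTree.Node 3 [:: form_encode g; form_encode h]
  | Or g h => GenTree.Node 4 [:: form_encode g; form_encode h]
  | Imp g h => GenTree.Node 5 [:: form_encode g; form_encode h]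
  end.

Fixpoint form_decode (t : GenTree.tree V) : form V :=
  match t with
  | GenTree.Leaf x => Var x
  | GenTree.Node 1 _ => Bot
  | GenTree.Node 2 [:: g] => Neg (form_decode g)
  | GenTree.Node 3 [:: g; h] => And (form_decode g) (form_decode h)
  | GenTree.Node 4 [:: g; h] => Or (form_decode g) (form_decode h)
  | GenTree.Node 5 [:: g; h] => Imp (form_decode g) (form_decode h)
  | _ => Top
  end.

Lemma form_encodeK : cancel form_encode form_decode.
Proof. by elim=> //= [g ->|g -> h ->|g -> h ->|g -> h ->]. Qed.

HB.instance Definition _ := Equality.copy (form V) (can_type form_encodeK).

End FormEqType.

Fixpoint eval (V : Type) (v : V -> bool) (f : form V) : bool :=
  match f with
  | Var x => v x
  | Top => true
  | Bot => false
  | Neg g => ~~ eval v g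
  | And g h => eval v g && eval v h
  | Or g h => eval v g || eval v h
  | Imp g h => eval v g ==> eval v h
  end.

Fixpoint subst (V W : Type) (s : V -> form W) (f : form V) : form W :=
  match f with
  | Var x => s x
  | Top => Top
  | Bot => Bot
  | Neg g => Neg (subst s g)
  | And g h => And (subst s g) (subst s h)
  | Or g h => Or (subst s g) (subst s h)
  | Imp g h => Imp (subst s g) (subst s h)
  end.

(* Number of symbols of f in prefix notation; an occurrence of a variable
   counts as one symbol. *)
Fixpoint form_size (V : Type) (f : form V) : nat :=
  match f with
  | Var _ | Top | Bot => 1
  | Neg g => (form_size g).+1
  | And g h | Or g h | Imp g h => (form_size g + form_size h).+1
  end.

(* Iterated conjunction and disjunction associate to the right; the constants
   are used for the empty sequence only. *)
Fixpoint big_and (V : Type) (s : seq (form V)) : form V :=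
  match s with
  | [::] => Top
  | [:: f] => f
  | f :: s' => And f (big_and s')
  end.

Fixpoint big_or (V : Type) (s : seq (form V)) : form V :=
  match s with
  | [::] => Bot
  | [:: f] => f
  | f :: s' => Or f (big_or s')
  end.

Definition entails (V : eqType) (G : seq (form V)) (f : form V) : Prop :=
  forall v : V -> bool, (forall g, g \in G -> eval v g) -> eval v f.

(* A schematic rule: its premises and its conclusion, with the elements of nat
   as schematic variables. An axiom scheme is a rule without premises. *)
Notation rule := (seq (form nat) * form nat)%type.

(* derivation R G p: the sequence of lines p, in order, is a derivation from
   the hypotheses G by means of the rules in R. *)
Inductive derivation (R : seq rule) (V : eqType) (G : seq (form V)) :
    seq (form V) -> Prop :=
| DerNil : derivation R G [::]
| DerHyp (p : seq (form V)) (f : form V) :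
    derivation R G p -> f \in G -> derivation R G (rcons p f)
| DerRule (p : seq (form V)) (r : rule) (s : nat -> form V) :
    derivation R G p -> r \in R ->
    (forall g, g \in r.1 -> subst s g \in p) ->
    derivation R G (rcons p (subst s r.2)).

Definition proof_of (R : seq rule) (V : eqType) (G : seq (form V))
    (f : form V) (p : seq (form V)) : Prop :=
  derivation R G p /\ exists q, p = rcons q f.

Definition proof_size (V : Type) (p : seq (form V)) : nat :=
  \sum_(f <- p) form_size f.

Record frege_system (R : seq rule) : Prop := FregeSystem {
  frege_sound : forall (G : seq (form nat)) (f : form nat),
    (exists p, proof_of R G f p) -> entails G f;
  frege_complete : forall (G : seq (form nat)) (f : form nat),
    entails G f -> exists p, proof_of R G f p
}.

(* Var (A, i) says that vertex A has colour i; variables with #|A| != k do not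
   occur in the formula. The last disjunction ranges over ordered pairs. *)
Definition kneser (n k : nat) : form ({set 'I_n} * 'I_(n - 2 * k + 1)) :=
  Imp
    (big_and [seq big_or [seq Var (A, i) | i <- enum 'I_(n - 2 * k + 1)]
             | A <- enum [set A : {set 'I_n} | #|A| == k]])
    (big_or [seq big_or [seq And (Var (AB.1, i)) (Var (AB.2, i))
                        | i <- enum 'I_(n - 2 * k + 1)]
            | AB <- enum [set AB : {set 'I_n} * {set 'I_n} |
                [&& #|AB.1| == k, #|AB.2| == k & AB.1 :&: AB.2 == set0]]]).

(* Main.v *)
Require Import Defs.
From mathcomp Require Import all_boot.
From mathcomp Require Import zify.
Set Implicit Arguments.
Unset Strict Implicit.
Unset Printing Implicit Defensive.

(* By the theorem of Lovasz the formulas are tautologies. It is obtained from the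
   octahedral Tucker lemma, by counting alternating flags of signed sets modulo 2.

   A short Frege proof is a shallow decision tree whose queries are formulas and
   whose leaves are local inconsistencies; it is enough to refute the assignment
   that makes the formula false by a tree of polylogarithmic depth that queries
   formulas of quasi-polynomial size. For a colouring of the k-subsets of [n] with
   m = n - 2k + 1 colours, call a colour a star if its sets have a common element, and
   remove all stars together with one centre for each. At least 2k - 1 more vertices
   than colours remain, and every k-set of remaining vertices has a colour that is
   not a star. If [i] is not a star, a set A of colour [i] and, for each a in A, a set
   of colour [i] avoiding a have a union W_i of at most k + k^2 elements, and every set
   of colour [i] contains two elements of W_i, unless two disjoint sets have colour [i].
   If many colours remain, averaging gives a vertex that lies in boundedly many W_i,
   and k such vertices chosen greedily form a set with at most one element in each W_i,
   a contradiction. If the number of remaining colours is bounded, all remaining colours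
   and as many vertices as needed are queried, and Lovasz's theorem applies. The counting
   arguments use the formulas "exactly j of the f_x are true", which divide and conquer
   makes quasi-polynomial; a failing inequality between sums is located by descending
   through the recursion. *)

(** * Lovasz's theorem *)

(** A tree of depth [d] yields a proof of about [2^d] times the formula size, so no step may scan a
    list of polynomial length: disjunctions are met by binary search, sums by descent in a balanced
    tree, and each step costs a polynomial in [h] and [e], where [2^h] bounds the number of vertices
    and [2^e] the lists indexed by pairs of k-sets and a vertex. The colouring is not known, so
    whatever the argument picks must be described by formulas. Always picking the first candidate
    makes the pick unique; this is what limits a star to one centre and a witness set to k + k^2
    elements. Two elements of W_i in each set of colour [i]: such a set meets A in some a, and meets
    the chosen set avoiding a in some b, which therefore differs from a. Lovasz's theorem is not
    formalized inside the Frege system. It is applied from outside at a leaf, where the colours of a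
    number of sets bounded in terms of k are already known, and only says which two of them
    clash. *)

Lemma addb_involution (T : eqType) (s : seq T) (P : pred T) (f : T -> T) :
  uniq s -> {in s, forall x, f x \in s} -> {in s, forall x, f (f x) = x} ->
  {in s, forall x, f x != x} -> {in s, forall x, P (f x) = P x} ->
  \big[addb/false]_(x <- s) P x = false.
Proof.
elim: {s}(size s).+1 {-2}s (ltnSn (size s)) => // N IH [|x s] sz us fs ff fn Pf.
  by rewrite big_nil.
have xin : x \in x :: s by rewrite mem_head.
have fxs : f x \in s.
  by have := fs _ xin; rewrite inE (negbTE (fn _ xin)).
rewrite big_cons (perm_big _ (perm_to_rem fxs)) big_cons /= (Pf _ xin) addbA addbb /=.
case/andP: us => xs us.
have inr y : y \in rem (f x) s -> [/\ y \in x :: s, y != x & y != f x].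
  rewrite (mem_rem_uniq _ us) !inE => /andP[-> ys]; split=> //; first by rewrite ys orbT.
  by apply: contraNneq xs => <-.
apply: IH.
- by have := perm_size (perm_to_rem fxs) => /=; move: sz => /=; lia.
- exact: rem_uniq.
- move=> y /inr[ys yx yf]; rewrite (mem_rem_uniq _ us) !inE.
  have := fs _ ys; rewrite inE => /orP[/eqP e|->].
    by case/eqP: yf; rewrite -(ff _ ys) e.
  rewrite andbT; apply: contraNneq yx => e; by rewrite -(ff _ ys) e ff.
- by move=> y /inr[ys _ _]; apply: ff.
- by move=> y /inr[ys _ _]; apply: fn.
- by move=> y /inr[ys _ _]; apply: Pf.
Qed.

(** * Alternating sequences of signed labels, counted modulo 2 *)

Fixpoint alt (b : bool) (s : bitseq) : bool :=
  if s is x :: s' then (x == b) && alt (~~ b) s' else true.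

Fixpoint dels (T : Type) (s : seq T) : seq (seq T) :=
  if s is x :: s' then s' :: map (cons x) (dels s') else [::].

(** If a nonempty [s] alternates from [b], only the deletion of its last letter counts; if it
    alternates from [~~ b], only that of its first. Any other word that a deletion makes alternating
    has exactly one pair of equal neighbours, and either of the two may be deleted, so the count is
    even. *)
Lemma alt_dels b s :
  \big[addb/false]_(t <- dels s) alt b t = alt b s (+) alt (~~ b) s.
Proof.
elim: s b => [|x s IH] b; first by rewrite big_nil.
rewrite /= big_cons big_map.
under eq_bigr => t _ do rewrite /=.
case: (altP (x =P b)) => [->|xb] /=.
  by rewrite IH negbK; case: b; case: (alt true s); case: (alt false s).
rewrite big1 //= addbF.
have -> : x == ~~ b by move: xb; case: (x); case: (b).
by rewrite negbK.
Qed.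

(* Labels are coded as natural numbers: [c./2] is the absolute value and [odd c]
   the sign, so that sorting with [leq] sorts by absolute value. *)
Definition flip (c : nat) := if odd c then c.-1 else c.+1.

Lemma odd_flip c : odd (flip c) = ~~ odd c.
Proof. by rewrite /flip; case: ifP; lia. Qed.
Lemma flipK : involutive flip.
Proof.
move=> c; rewrite /flip; case oc: (odd c); last by rewrite /= oc.
by case: c oc => //= c /negbTE ->.
Qed.

Definition alternating b (s : seq nat) := alt b (map odd (sort leq s)).

Lemma perm_alternating b s t : perm_eq s t -> alternating b s = alternating b t.
Proof.
move=> st; rewrite /alternating; congr (alt b (map odd _)).
by apply/perm_sortP => //; [apply: leq_total|apply: leq_trans|apply: anti_leq].
Qed.

Lemma sort_uniqueness s t : sorted leq t -> perm_eq s t -> sort leq s = t.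
Proof.
move=> st pst; apply: (sorted_eq leq_trans anti_leq) => //.
  by apply: sort_sorted; apply: leq_total.
by rewrite perm_sort.
Qed.

(** A flip exchanges the codes [2a] and [2a + 1] only. Without opposite labels in [s] it therefore
    preserves the sorted order and just reverses all signs. *)
Lemma alternating_flip b s : {in s &, forall x y, y != flip x} ->
  alternating b (map flip s) = alternating (~~ b) s.
Proof.
move=> nc; rewrite /alternating (@sort_uniqueness _ (map flip (sort leq s))).
- rewrite -map_comp; elim: (sort leq s) b => //= x t IH b.
  by rewrite odd_flip IH; case: (odd x); case: b.
- have : {in sort leq s &, forall x y, y != flip x}.
    by move=> x y; rewrite !mem_sort; apply: nc.
  have : sorted leq (sort leq s) by apply: sort_sorted; apply: leq_total.
  elim: (sort leq s) => //= x t IH xt nct.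
  have {}IH : sorted leq (map flip t).
    apply: IH; first exact: path_sorted xt.
    by move=> a c ia ic; apply: nct; rewrite inE ?ia ?ic orbT.
  case: t xt nct IH => //= y t /andP[xy _] nct ->; rewrite andbT.
  have yx : y != flip x by apply: nct; rewrite !inE eqxx ?orbT.
  by move: yx xy; rewrite /flip; case: ifP; case: ifP; lia.
- by apply: perm_map; rewrite perm_sym perm_sort.
Qed.

Lemma alternating_uniq b s : alternating b s -> uniq s.
Proof.
rewrite /alternating -(sort_uniq leq).
have : sorted leq (sort leq s) by apply: sort_sorted; apply: leq_total.
move: (sort leq s) => t st at_.
suff st' : sorted ltn t by apply: sorted_uniq st'; [apply: ltn_trans|apply: ltnn].
elim: t b st at_ => //= x [|y t] IH b //= /andP[xy yt] /and3P[/eqP ox /eqP oy at_].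
have /= -> := IH (~~ b) yt; last by rewrite oy eqxx.
rewrite andbT.
by move: xy ox oy; rewrite leq_eqVlt => /orP[/eqP ->|//] ->; case: (b).
Qed.

Lemma alternating_dels b (s : seq nat) :
  \big[addb/false]_(t <- dels s) alternating b t
  = alternating b s (+) alternating (~~ b) s.
Proof.
rewrite {2 3}/alternating -alt_dels.
have dmap (g : nat -> bool) r : dels (map g r) = map (map g) (dels r).
  by elim: r => //= x r ->; rewrite -!map_comp.
rewrite dmap big_map.
(* [dels] deletes by position and [rem] by value; the results agree up to permutation, which lets
   the sum be compared with that of the sorted sequence. *)
have rems (r : seq nat) (F : seq nat -> bool) : (forall p q, perm_eq p q -> F p = F q) ->
    \big[addb/false]_(t <- dels r) F t = \big[addb/false]_(x <- r) F (rem x r).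
  elim: r F => [|x r IH] F FP; first by rewrite !big_nil.
  rewrite /= !big_cons eqxx big_map (IH (F \o cons x)); last first.
    by move=> p q pq; apply: FP; rewrite perm_cons.
  congr (_ (+) _); rewrite big_seq [RHS]big_seq; apply: eq_bigr => y yr /=.
  apply: FP; case: eqP => [->|//]; by rewrite perm_sym perm_to_rem.
rewrite (rems _ (alternating b)); last exact: perm_alternating.
transitivity (\big[addb/false]_(t <- dels (sort leq s)) alternating b t); last first.
  have sub t : t \in dels (sort leq s) -> sorted leq t.
    have : sorted leq (sort leq s) by apply: sort_sorted; apply: leq_total.
    have dsub (r : seq nat) q : q \in dels r -> subseq q r.
      elim: r q => //= x r IH q; rewrite inE => /orP[/eqP ->|/mapP[p pr ->]].
        exact: subseq_cons.
      by rewrite /= eqxx; apply: IH.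
    by move=> ss /dsub td; apply: (subseq_sorted leq_trans td ss).
  rewrite big_seq [RHS]big_seq; apply: eq_bigr => t /sub st.
  by rewrite /alternating (sort_uniqueness st).
rewrite (rems _ (alternating b)); last exact: perm_alternating.
rewrite (perm_big (sort leq s)); last by rewrite perm_sym perm_sort.
rewrite big_seq [RHS]big_seq; apply: eq_bigr => x _; apply: perm_alternating.
have xs : (x \in s) || (x \notin s) by case: (_ \in _).
case/orP: xs => xs.
  rewrite -(perm_cons x); apply: (@perm_trans _ (sort leq s)).
    by rewrite perm_sym perm_sort perm_to_rem.
  by rewrite perm_to_rem // mem_sort.
by rewrite !rem_id ?mem_sort // perm_sym perm_sort.
Qed.

Definition del (T : Type) j (s : seq T) := take j s ++ drop j.+1 s.

Lemma del_cat (T : Type) (s t : seq T) x : del (size s) (s ++ x :: t) = s ++ t.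
Proof. by rewrite /del take_size_cat // -cat_rcons drop_size_cat ?size_rcons. Qed.

Lemma dels_del (T : Type) (s : seq T) :
  dels s = [seq del j s | j <- iota 0 (size s)].
Proof.
elim: s => //= x s ->; rewrite /del /= drop0; congr (_ :: _).
by rewrite -[1]/(1 + 0) iotaDl -!map_comp.
Qed.

(** * Maximal flags of signed sets *)

Notation signed := (nat * bool)%type.

Lemma unzip1_rcons (l : seq signed) x : unzip1 (rcons l x) = rcons (unzip1 l) x.1.
Proof. exact: map_rcons. Qed.

Lemma iota0S d : iota 0 d.+1 = rcons (iota 0 d) d.
Proof. by rewrite -addn1 iotaD cats1. Qed.

(** A maximal flag of signed sets on the vertices below [d] is coded by the order in which the
    signed vertices enter; the members of the flag are the nonempty prefixes. *)
Definition full d : seq (seq signed) :=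
  [seq zip p (val t) | p <- permutations (iota 0 d), t <- enum {: d.-tuple bool}].

Lemma mem_full d l : (l \in full d) = perm_eq (unzip1 l) (iota 0 d).
Proof.
apply/allpairsP/idP => [[[p t] /= [pin _ ->]]|pl].
  move: pin; rewrite mem_permutations => pin.
  by rewrite unzip1_zip // size_tuple (perm_size pin) size_iota.
have sz : size (unzip2 l) == d by rewrite size_map -(size_map fst) (perm_size pl) size_iota.
exists (unzip1 l, Tuple sz); split; rewrite ?mem_permutations ?mem_enum //=.
by rewrite zip_unzip.
Qed.

Lemma uniq_full d : uniq (full d).
Proof.
apply: allpairs_uniq; rewrite ?permutations_uniq ?enum_uniq // => -[p t] [q u].
move=> /allpairsP[[p' t'] /= [pin _ [-> ->]]] /allpairsP[[q' u'] /= [qin _ [-> ->]]] e.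
move: pin qin; rewrite !mem_permutations => /perm_size sp /perm_size sq.
rewrite size_iota in sp sq.
have ep : p' = q'.
  by rewrite -[p'](@unzip1_zip _ _ _ t') ?e ?unzip1_zip ?size_tuple ?sp ?sq.
congr (_, _) => //; apply: val_inj.
by rewrite -[val t'](@unzip2_zip _ _ p') ?e ?unzip2_zip ?size_tuple ?sp ?sq.
Qed.

Definition swap (T : Type) j (s : seq T) :=
  take j s ++ (if drop j s is a :: b :: q then b :: a :: q else drop j s).

Lemma swap_cat (T : Type) (p q : seq T) a b :
  swap (size p) (p ++ a :: b :: q) = p ++ b :: a :: q.
Proof. by rewrite /swap take_size_cat // drop_size_cat. Qed.

Lemma split_pair (T : Type) j (s : seq T) : j.+1 < size s ->
  exists p a b q, s = p ++ a :: b :: q /\ size p = j.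
Proof.
move=> js; have x0 : T by case: s js.
exists (take j s), (nth x0 s j), (nth x0 s j.+1), (drop j.+2 s).
by rewrite -!drop_nth ?cat_take_drop ?size_takel //; lia.
Qed.

Definition flip_last (l : seq signed) :=
  if rev l is (q, b) :: r then rev ((q, ~~ b) :: r) else l.

Lemma flip_last_rcons l q b : flip_last (rcons l (q, b)) = rcons l (q, ~~ b).
Proof. by rewrite /flip_last rev_rcons rev_cons revK. Qed.

Definition antipode (l : seq signed) : seq signed := [seq (x.1, ~~ x.2) | x <- l].

Lemma antipodeK : involutive antipode.
Proof. by elim=> //= -[q b] l; rewrite /antipode /= negbK => ->. Qed.

Lemma mem_antipode l x b : ((x, b) \in antipode l) = ((x, ~~ b) \in l).
Proof.
by elim: l => //= -[y c] l IH; rewrite !inE IH !xpair_eqE; case: (b) (c) => -[].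
Qed.

Lemma unzip1_antipode l : unzip1 (antipode l) = unzip1 l.
Proof. by rewrite /unzip1 /antipode -map_comp. Qed.

Lemma signed_inj (l : seq signed) x a b :
  uniq (unzip1 l) -> (x, a) \in l -> (x, b) \in l -> a = b.
Proof.
elim: l => //= -[y d] l IH /andP[yl ul]; rewrite !inE !xpair_eqE.
case: eqP => [-> /=|_] //=; last exact: IH.
have nl e : (y, e) \in l = false.
  by apply: contraNF yl => yl; apply/mapP; exists (y, e).
by rewrite !nl !orbF => /eqP -> /eqP.
Qed.

(** * The octahedral Tucker lemma *)

Section Fan.

Variables (N : nat) (lam : seq signed -> nat).

Definition dom (l : seq signed) := uniq (unzip1 l) && all (fun q => q < N) (unzip1 l).

Fixpoint labels (p r : seq signed) : seq nat :=
  if r is x :: r' then lam (rcons p x) :: labels (rcons p x) r' else [::].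

Lemma size_labels p r : size (labels p r) = size r.
Proof. by elim: r p => //= x r IH p; rewrite IH. Qed.

Lemma labels_cat p r1 r2 : labels p (r1 ++ r2) = labels p r1 ++ labels (p ++ r1) r2.
Proof. by elim: r1 p => [|x r IH] p /=; rewrite ?cats0 // IH cat_rcons. Qed.

Lemma labelsP p r c : c \in labels p r ->
  exists r1 r2, [/\ r = r1 ++ r2, r1 != [::] & c = lam (p ++ r1)].
Proof.
elim: r p => //= x r IH p; rewrite inE => /orP[/eqP ->|/IH[r1 [r2 [-> _ ->]]]].
  by exists [:: x], r; rewrite cats1.
by exists (x :: r1), r2; rewrite cat_rcons.
Qed.

Hypothesis lam_perm : forall l l', dom l -> l != [::] -> perm_eq l l' -> lam l = lam l'.
Hypothesis lam_anti : forall l, dom l -> l != [::] -> lam (antipode l) = flip (lam l).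
Hypothesis lam_lt : forall l, dom l -> l != [::] -> (lam l)./2 < N.-1.
Hypothesis no_edge : forall l r, dom (l ++ r) -> l != [::] -> lam (l ++ r) != flip (lam l).

Lemma dom_catl l r : dom (l ++ r) -> dom l.
Proof.
by rewrite /dom /unzip1 map_cat cat_uniq all_cat => /andP[/and3P[-> _ _] /andP[-> _]].
Qed.

Lemma dom_full d l : d <= N -> l \in full d -> dom l.
Proof.
rewrite mem_full => dN pl; rewrite /dom (perm_uniq pl) iota_uniq (perm_all _ pl).
by apply/allP => q; rewrite mem_iota; lia.
Qed.

Lemma labels_perm p p' r : dom (p ++ r) -> perm_eq p p' -> labels p r = labels p' r.
Proof.
elim: r p p' => //= x r IH p p' dm pp.
have ppx : perm_eq (rcons p x) (rcons p' x) by rewrite -!cats1 perm_cat2r.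
rewrite -cat_rcons in dm; rewrite (IH _ (rcons p' x)) //; congr (_ :: _).
by apply: lam_perm ppx; [apply: dom_catl dm|case: (p)].
Qed.

Lemma labels_anti l : dom l -> labels [::] (antipode l) = map flip (labels [::] l).
Proof.
rewrite -[labels _ (antipode l)]/(labels (antipode [::]) (antipode l)) -{1}[l]cat0s.
elim: l [::] => //= x r IH p dm.
rewrite -cat_rcons in dm; rewrite -map_rcons IH //; congr (_ :: _).
by apply: lam_anti; [apply: dom_catl dm|case: (p)].
Qed.

Lemma labels_no_edge l : dom l -> {in labels [::] l &, forall x y, y != flip x}.
Proof.
move=> dl x y /labelsP[r1 [r2 [e n1 ->]]] /labelsP[s1 [s2 [f m1 ->]]] /=.
have pre (a1 a2 b1 b2 : seq signed) : a1 ++ a2 = b1 ++ b2 -> size a1 <= size b1 ->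
    exists t, b1 = a1 ++ t.
  move=> ab le; exists (drop (size a1) b1).
  by rewrite -{1}(cat_take_drop (size a1) b1) -(takel_cat b2 le) -ab take_size_cat.
have rs : r1 ++ r2 = s1 ++ s2 by rewrite -e -f.
have dr : dom r1 by move: dl; rewrite e => /dom_catl.
have ds : dom s1 by move: dl; rewrite f => /dom_catl.
case: (leqP (size r1) (size s1)) => [le|/ltnW le].
  by have [t sE] := pre _ _ _ _ rs le; rewrite sE; apply: no_edge; rewrite -?sE.
have [t rE] := pre _ _ _ _ (esym rs) le.
apply/negP => /eqP h; have : lam r1 = flip (lam s1) by rewrite h flipK.
by apply/eqP; rewrite rE; apply: no_edge; rewrite -?rE.
Qed.

(** An upper hemisphere: of two antipodal flags of [full d.+1] exactly one lies here. *)
Definition hemi d := [seq l <- full d.+1 | (d, true) \in l].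

(** Exchanging the entries [j] and [j.+1] alters only the label at position [j], which is the
    deleted one, so the flags cancel in pairs: this facet lies in exactly two flags of the
    hemisphere. *)
Lemma swap_even d j : d < N -> j < d ->
  \big[addb/false]_(l <- hemi d) alternating true (del j (labels [::] l)) = false.
Proof.
move=> dN jd.
have sp l : l \in hemi d -> exists p a b q,
    [/\ l = p ++ a :: b :: q, size p = j, swap j l = p ++ b :: a :: q & a != b].
  rewrite mem_filter mem_full => /andP[_ pl].
  have sl : size l = d.+1 by rewrite -(size_map fst) (perm_size pl) size_iota.
  have := @split_pair _ j l; rewrite sl ltnS => /(_ jd)[p [a [b [q [e sp]]]]].
  exists p, a, b, q; rewrite -sp e swap_cat; split=> //.
  have : uniq l by rewrite (@map_uniq _ _ fst) // (perm_uniq pl) iota_uniq.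
  rewrite e cat_uniq => /and3P[_ _ /= /andP[ab _]].
  by move: ab; rewrite inE negb_or => /andP[].
have sperm l : l \in hemi d -> perm_eq (swap j l) l.
  move=> /sp[p [a [b [q [-> _ -> _]]]]]; rewrite perm_cat2l.
  by apply/permP => z /=; lia.
apply: (@addb_involution _ _ _ (swap j)).
- by rewrite filter_uniq // uniq_full.
- move=> l lh; have pl := sperm l lh; move: lh.
  rewrite !mem_filter !mem_full (perm_mem pl) => /andP[-> ql].
  by rewrite (perm_trans _ ql) // perm_map.
- move=> l /sp[p [a [b [q [-> <- _ _]]]]]; by rewrite !swap_cat.
- move=> l /sp[p [a [b [q [-> <- _ ab]]]]]; rewrite swap_cat.
  by rewrite eqseq_cat // eqxx /= eqseq_cons eq_sym (negbTE ab).
move=> l lh; have /sp[p [a [b [q [e sj _ _]]]]] := lh.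
have dl : dom l by apply: (@dom_full d.+1) => //; move: lh; rewrite mem_filter => /andP[].
have pe : perm_eq (rcons (rcons p a) b) (rcons (rcons p b) a).
  by apply/permP => z; rewrite -!cats1 !count_cat /=; lia.
rewrite e -sj swap_cat !labels_cat /= -(size_labels [::] p) !del_cat.
congr (alternating _ (_ ++ _)).
have dab : dom (rcons (rcons p a) b ++ q) by rewrite !cat_rcons -e.
rewrite -(labels_perm dab pe); congr (_ :: _); symmetry.
by apply: (lam_perm (dom_catl dab) _ pe); case: (p).
Qed.

(** Without its last member a flag has two completions, differing in the sign of the last vertex,
    and both lie in the hemisphere unless that vertex is [d]. The uncancelled flags end with
    [(d, true)] and form the boundary sphere, one dimension lower. *)
Lemma last_parity d : d < N ->
  \big[addb/false]_(l <- hemi d) alternating true (del d (labels [::] l))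
  = \big[addb/false]_(l <- full d) alternating true (labels [::] l).
Proof.
move=> dN.
have sz l : l \in hemi d -> size l = d.+1.
  rewrite mem_filter mem_full -(size_map fst) => /andP[_] pl.
  by rewrite (perm_size pl) size_iota.
have delE l x : size l = d -> del d (labels [::] (rcons l x)) = labels [::] l.
  move=> sl; rewrite -cats1 labels_cat /= /del take_size_cat ?size_labels //.
  by rewrite drop_oversize ?cats0 // size_cat size_labels sl addn1.
rewrite (bigID (fun l => last (0, true) l == (d, true))) /=.
have -> : \big[addb/false]_(l <- hemi d | last (0, true) l != (d, true))
    alternating true (del d (labels [::] l)) = false.
  rewrite -big_filter.
  have sp l : l \in [seq l <- hemi d | last (0, true) l != (d, true)] ->
      exists l' q b, [/\ l = rcons l' (q, b), size l' = d, (q, b) != (d, true),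
        (d, true) \in l' & perm_eq (rcons (unzip1 l') q) (iota 0 d.+1)].
    rewrite mem_filter => /andP[ll lh]; have := sz _ lh; move: lh ll.
    rewrite mem_filter mem_full.
    case/lastP: l => // l [q b]; rewrite last_rcons mem_rcons inE unzip1_rcons size_rcons.
    case/andP=> /orP[/eqP ->|dl] pl; first by rewrite eqxx.
    by move=> qb [sl]; exists l, q, b.
  apply: (@addb_involution _ _ _ flip_last).
  - by rewrite !filter_uniq // uniq_full.
  - move=> _ /sp[l [q [b [-> sl qb dl pl]]]]; rewrite flip_last_rcons.
    rewrite !mem_filter mem_full last_rcons mem_rcons inE dl orbT unzip1_rcons pl !andbT.
    have : uniq (rcons (unzip1 l) q) by rewrite (perm_uniq pl) iota_uniq.
    rewrite rcons_uniq; case: eqP => // -[-> _].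
    by rewrite -[d]/((d, true).1) map_f.
  - by move=> _ /sp[l [q [b [-> _ _ _ _]]]]; rewrite !flip_last_rcons negbK.
  - move=> _ /sp[l [q [b [-> _ _ _ _]]]]; rewrite flip_last_rcons.
    by apply/eqP => /rcons_inj[] /eqP; case: (b).
  - by move=> _ /sp[l [q [b [-> sl _ _ _]]]]; rewrite flip_last_rcons !delE.
rewrite addbF.
rewrite -big_filter.
have pE : perm_eq [seq l <- hemi d | last (0, true) l == (d, true)]
    [seq rcons l (d, true) | l <- full d].
  apply: uniq_perm.
  - by rewrite !filter_uniq // uniq_full.
  - by rewrite map_inj_uniq ?uniq_full // => x y /rcons_inj[].
  move=> l; rewrite !mem_filter mem_full; apply/idP/mapP.
    case/lastP: l => [/and3P[_ //]|l x]; rewrite last_rcons => /and3P[/eqP -> _ pl].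
    exists l => //; rewrite mem_full.
    by move: pl; rewrite unzip1_rcons iota0S -!cats1 perm_cat2r.
  case=> l'; rewrite mem_full => pl ->; rewrite last_rcons eqxx mem_rcons mem_head /=.
  by rewrite unzip1_rcons -/(iota 0 d.+1) iota0S -!cats1 perm_cat2r.
rewrite (perm_big _ pE) big_map; rewrite big_seq [RHS]big_seq.
apply: eq_bigr => l; rewrite mem_full => /perm_size; rewrite size_map size_iota => sl.
by rewrite delE.
Qed.

(** The count in [B] is odd for every [d]. Two antipodal flags contribute both alternation patterns
    of one of them, which [alternating_dels] turns into deletions of one label; all deletions but
    the last cancel, and the last gives the count for the preceding dimension. For [d = N] an
    alternating flag exists; its N labels have distinct absolute values, but only N - 1 values are
    available. *)
Lemma octahedral_tucker : N = 0.
Proof.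
case: (posnP N) => // N0; exfalso.
have hemi_dom d l : d < N -> l \in hemi d -> dom l.
  by move=> dN; rewrite mem_filter => /andP[_ /dom_full]; apply.
have B d : d <= N -> \big[addb/false]_(l <- full d) alternating true (labels [::] l).
  elim: d => [|d IH] dN.
    have -> : \big[addb/false]_(l <- full 0) alternating true (labels [::] l)
            = \big[addb/false]_(l <- [:: [::]]) alternating true (labels [::] l).
      apply: perm_big; apply: uniq_perm; rewrite ?uniq_full // => l.
      rewrite mem_full inE; case: l => //= x l.
      by apply/idP => /perm_size.
    by rewrite big_seq1.
  rewrite (bigID (fun l => (d, true) \in l)) /=.
  rewrite -[X in X (+) _]big_filter -[X in _ (+) X]big_filter -/(hemi d).
  have pE : perm_eq [seq l <- full d.+1 | (d, true) \notin l] (map antipode (hemi d)).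
    apply: uniq_perm; rewrite ?map_inj_uniq ?filter_uniq ?uniq_full //.
      exact: inv_inj antipodeK.
    move=> l; rewrite -{2}[l]antipodeK mem_map; last exact: inv_inj antipodeK.
    rewrite !mem_filter mem_antipode !mem_full unzip1_antipode [~~ true]/=.
    case: (boolP (perm_eq (unzip1 l) _)) => pl; rewrite ?andbF // !andbT.
    have ul : uniq (unzip1 l) by rewrite (perm_uniq pl) iota_uniq.
    have : d \in unzip1 l by rewrite (perm_mem pl) mem_iota /=.
    case/mapP => -[y b] yb /= e; rewrite -e in yb; apply/idP/idP.
      by case: b yb => [->|].
    by move=> df; apply/negP => dt; have := signed_inj ul df dt.
  rewrite (perm_big _ pE) big_map -big_split /=.
  move: (IH (ltnW dN)); rewrite -last_parity // => hl.
  have -> : \big[addb/false]_(l <- hemi d) (alternating true (labels [::] l) (+)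
               alternating true (labels [::] (antipode l)))
    = \big[addb/false]_(l <- hemi d) \big[addb/false]_(j <- iota 0 d.+1)
           alternating true (del j (labels [::] l)).
    rewrite big_seq [RHS]big_seq; apply: eq_bigr => l lh.
    have dl := hemi_dom _ _ dN lh.
    rewrite labels_anti // alternating_flip; last exact: labels_no_edge.
    have := alternating_dels true (labels [::] l); rewrite dels_del big_map size_labels => <-.
    suff -> : size l = d.+1 by [].
    move: lh; rewrite mem_filter mem_full -(size_map fst) => /andP[_] pl.
    by rewrite (perm_size pl) size_iota.
  rewrite exchange_big iota0S -cats1 big_cat big_seq1 /=.
  rewrite big1_seq ?addFb // => j; rewrite mem_iota => /andP[_ jd].
  by rewrite swap_even.
have : has (fun l => alternating true (labels [::] l)) (full N).
  apply/negPn/negP => /hasPn h; have := B N (leqnn _).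
  by rewrite big1_seq // => l /andP[_ /h /negbTE].
case/hasP => l lf /alternating_uniq ul.
have dl := dom_full (leqnn N) lf.
have : uniq (map half (labels [::] l)).
  rewrite map_inj_in_uniq // => x y xl yl.
  have := labels_no_edge dl xl yl; rewrite /flip.
  case: ifP => ox; lia.
move=> uh; have := @uniq_leq_size _ _ (iota 0 N.-1) uh.
rewrite size_map size_labels size_iota -(size_map fst).
move: lf; rewrite mem_full => /perm_size ->; rewrite size_iota => h.
suff : N <= N.-1 by lia.
apply: h => _ /mapP[c /labelsP[r1 [r2 [e n1 ->]]] ->].
by rewrite mem_iota add0n lam_lt //; move: dl; rewrite e => /dom_catl.
Qed.

End Fan.

(** * A labelling of signed sets from a proper colouring *)

Section Kneser.

Variables (N k M : nat) (c : {set 'I_N} -> nat).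

Definition side b (l : seq signed) := [set q : 'I_N | (val q, b) \in l].

Definition has_col b l i :=
  [exists S : {set 'I_N}, [&& S \subset side b l, #|S| == k & c S == i]].

Definition least_elt (l : seq signed) := find (fun q => q \in unzip1 l) (iota 0 N).

Definition least_col (l : seq signed) :=
  find (fun i => has_col true l i || has_col false l i) (iota 0 M).

(** Signed sets of at most 2k - 2 elements use their size as absolute value and the sign of their
    least element. A larger one has k elements on one side; it uses the least colour found inside a
    side, and the sign of that side. This makes (2k - 2) + M = N - 1 absolute values. *)
Definition label (l : seq signed) : nat :=
  if size l <= 2 * k - 2 then (size l).-1.*2 + ((least_elt l, true) \in l)
  else (2 * k - 2 + least_col l).*2 + has_col true l (least_col l).

Hypothesis k0 : 0 < k.
Hypothesis NE : N = M + 2 * k - 1.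
Hypothesis c_lt : forall S : {set 'I_N}, #|S| = k -> c S < M.
Hypothesis proper : forall S T : {set 'I_N}, #|S| = k -> #|T| = k -> S :&: T = set0 -> c S <> c T.

Lemma least_eltP l : dom N l -> l != [::] -> least_elt l \in unzip1 l.
Proof.
case: l => // x l /andP[_ al] _.
have h : has (fun q => q \in unzip1 (x :: l)) (iota 0 N).
  apply/hasP; exists x.1; rewrite ?mem_head //.
  by move: al => /= /andP[xN _]; rewrite mem_iota.
have := nth_find 0 h; rewrite nth_iota //.
by have := h; rewrite has_find size_iota.
Qed.

Lemma side_disjoint l : dom N l -> side true l :&: side false l = set0.
Proof.
case/andP=> ul _; apply/setP => q; rewrite !inE; apply/negP => /andP[t f].
by have := signed_inj ul t f.
Qed.

Lemma has_col_excl l i : dom N l -> has_col true l i -> has_col false l i -> False.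
Proof.
move=> dl /existsP[S /and3P[St /eqP Sk /eqP Si]] /existsP[T /and3P[Tf /eqP Tk /eqP Ti]].
apply: (proper Sk Tk); last by rewrite Si Ti.
by apply/eqP; rewrite -subset0 -(side_disjoint dl) setISS.
Qed.

Lemma size_sides l : dom N l -> size l <= #|side true l| + #|side false l|.
Proof.
case/andP=> ul al.
have := @uniq_leq_size _ l ([seq (val q, true) | q <- enum (side true l)] ++
                           [seq (val q, false) | q <- enum (side false l)]).
rewrite size_cat !size_map -!cardE; apply; first exact: map_uniq ul.
move=> [q b] ql; have qN : q < N by apply: (allP al); apply/mapP; exists (q, b).
by rewrite mem_cat; apply/orP; case: b ql => ql; [left|right]; apply/mapP;
   exists (Ordinal qN); rewrite // mem_enum inE.
Qed.

Lemma least_colP l : dom N l -> 2 * k - 2 < size l ->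
  least_col l < M /\
  has_col true l (least_col l) = ~~ has_col false l (least_col l).
Proof.
move=> dl sl.
have h : has (fun i => has_col true l i || has_col false l i) (iota 0 M).
  have [b kb] : exists b, k <= #|side b l|.
    have := size_sides dl; case: (leqP k #|side true l|) => [|lt] st; first by exists true.
    by exists false; lia.
  have [S Ss Sk] : exists2 S : {set 'I_N}, S \subset side b l & #|S| = k.
    case/card_geqP: kb => s [us <- sub]; exists [set x in s].
      by apply/subsetP => x; rewrite inE; apply: sub.
    by rewrite cardsE; apply/card_uniqP.
  apply/hasP; exists (c S); first by rewrite mem_iota c_lt.
  have : has_col b l (c S) by apply/existsP; exists S; rewrite Ss Sk !eqxx.
  by case: b {kb Ss} => ->; rewrite ?orbT.
have lM : least_col l < M by have := h; rewrite has_find size_iota.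
split=> //; have := nth_find 0 h; rewrite nth_iota // add0n -/(least_col l).
have := @has_col_excl l (least_col l) dl.
by case: has_col; case: has_col => //= /(_ isT isT).
Qed.

Lemma proper_colouring_absurd : False.
Proof.
have sidem b l l' : l =i l' -> side b l = side b l'.
  by move=> e; apply/setP => q; rewrite !inE e.
have colm b l l' i : l =i l' -> has_col b l i = has_col b l' i.
  by move=> e; rewrite /has_col (sidem _ _ _ e).
have sidea b l : side b (antipode l) = side (~~ b) l.
  by apply/setP => q; rewrite !inE mem_antipode.
have cola b l i : has_col b (antipode l) i = has_col (~~ b) l i.
  by rewrite /has_col sidea.
have flipD (x : nat) (b : bool) : flip (x.*2 + b) = x.*2 + ~~ b.
  by rewrite /flip oddD odd_double; case: b => /=; lia.
have half_D x (b : bool) : (x.*2 + b)./2 = x.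
  by rewrite halfD odd_double doubleK; case: b; rewrite ?addn0.
suff : N = 0 by lia.
apply: (@octahedral_tucker N label).
- move=> l l' dl _ p; have e := perm_mem p.
  have e1 : unzip1 l =i unzip1 l' by apply: perm_mem; apply: perm_map.
  have -> : label l = label l' => //; rewrite /label (perm_size p).
  have -> : least_elt l = least_elt l' by apply: eq_find => q; apply: e1.
  have -> : least_col l = least_col l' by apply: eq_find => i; rewrite !(colm _ _ _ _ e).
  by rewrite e (colm _ _ _ _ e).
- move=> l dl l0; rewrite /label size_map /least_elt unzip1_antipode -/(least_elt l).
  have -> : least_col (antipode l) = least_col l.
    by apply: eq_find => i; rewrite !cola orbC.
  case: leqP => sl; rewrite flipD; last first.
    have [_ h] := least_colP dl sl; by rewrite cola h negbK.
  have /mapP[[q b] ql /= qE] := least_eltP dl l0.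
  have ul : uniq (unzip1 l) by case/andP: dl.
  rewrite mem_antipode qE; congr (_ + nat_of_bool _) => /=.
  case: b ql qE => ql _; apply/idP/idP => //.
  - by move=> qf; have := signed_inj ul ql qf.
  - by rewrite ql.
  - by move=> _; apply/negP => qt; have := signed_inj ul ql qt.
- move=> l dl l0; rewrite /label; case: (leqP (size l)) => sl.
    by rewrite half_D; case: (l) l0 sl => //= x r _; lia.
  have [lM _] := least_colP dl sl.
  by rewrite half_D; lia.
(* Opposite labels on nested sets: two small ones would have the same size and coincide; a small and
   a large one differ in absolute value; for two large ones the bigger set would contain the same
   colour on both sides, on disjoint k-sets. *)
move=> l r dlr l0; have dl := dom_catl dlr.
have s0 : 0 < size l by case: (l) l0.
rewrite /label size_cat; case: (leqP (size l)) => sl; case: leqP => sr.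
- rewrite flipD; apply/eqP => h; have r0 : size r = 0.
    by move: h; case: (_ \in _); case: (_ \in _) => /=; lia.
  by move: h; rewrite (size0nil r0) cats0; case: (_ \in _); lia.
- by rewrite flipD; apply/eqP; case: (_ \in _); case: has_col => /=; lia.
- by lia.
have [_ h1] := least_colP dl sl.
rewrite flipD; apply/eqP => h.
have e : least_col (l ++ r) = least_col l.
  by move: h; case: has_col; case: has_col => /=; lia.
have mono b i : has_col b l i -> has_col b (l ++ r) i.
  case/existsP => S /and3P[Ss Sk Si]; apply/existsP; exists S; rewrite Sk Si !andbT.
  by apply: subset_trans Ss _; apply/subsetP => q; rewrite !inE mem_cat => ->.
move: h (mono true (least_col l)) (mono false (least_col l)) h1.
have := @has_col_excl _ (least_col l) dlr; rewrite e.
do 4 case: has_col => //=; lia.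
Qed.

End Kneser.

(* Lovasz's theorem. *)
Theorem kneser_monochromatic (T : finType) (C : eqType) (X : {set T}) (k : nat)
    (ys : seq C) (col : {set T} -> C) :
  0 < k -> size ys + 2 * k - 1 <= #|X| ->
  (forall S : {set T}, S \subset X -> #|S| = k -> col S \in ys) ->
  exists S S' : {set T}, [/\ S \subset X, S' \subset X, #|S| = k & #|S'| = k] /\
    S :&: S' = set0 /\ col S = col S'.
Proof.
move=> k0 XN cys; set N := size ys + 2 * k - 1 in XN.
pose f (i : 'I_N) : T := enum_val (widen_ord XN i).
have fX i : f i \in X by apply: enum_valP.
have fI : injective f by move=> i j /enum_val_inj [] /ord_inj.
have fsub (S : {set 'I_N}) : f @: S \subset X by apply/subsetP => _ /imsetP[i _ ->].
have fcard (S : {set 'I_N}) : #|f @: S| = #|S| by apply: card_imset.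
pose c (S : {set 'I_N}) := index (col (f @: S)) ys.
case: (boolP [exists S : {set 'I_N}, exists S' : {set 'I_N},
    [&& #|S| == k, #|S'| == k, S :&: S' == set0 & c S == c S']]) => [|no].
  case/existsP => S /existsP[S' /and4P[/eqP Sk /eqP Sk' /eqP d /eqP e]].
  exists (f @: S), (f @: S'); rewrite !fcard !fsub -imsetI ?d ?imset0; last first.
    by move=> x y _ _; apply: fI.
  do 2 split=> //.
  have /= ii := @index_inj C (col set0) ys.
  by apply: (ii _ _ _ _ e); apply: cys; rewrite ?fcard.
exfalso; apply: (@proper_colouring_absurd N k (size ys) c k0 erefl).
  by move=> S Sk; rewrite index_mem cys ?fcard.
move=> S S' Sk Sk' d e; case/negP: no; apply/existsP; exists S.
by apply/existsP; exists S'; rewrite Sk Sk' d e !eqxx.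
Qed.

(** * Simulating decision trees in a Frege system *)

Notation lit V := (form V * bool)%type.

Definition schemas : seq (seq (lit nat)) :=
  let x := Var 0 in let y := Var 1 in
  [:: [:: (x, true); (x, false)]; [:: (Top, false)]; [:: (Bot, true)];
      [:: (Neg x, true); (x, true)]; [:: (Neg x, false); (x, false)];
      [:: (And x y, true); (x, false)]; [:: (And x y, true); (y, false)];
      [:: (And x y, false); (x, true); (y, true)];
      [:: (Or x y, true); (x, false); (y, false)];
      [:: (Or x y, false); (x, true)]; [:: (Or x y, false); (y, true)];
      [:: (Imp x y, true); (x, true); (y, false)];
      [:: (Imp x y, false); (x, false)]; [:: (Imp x y, false); (y, true)]].

(* [refutation s d G]: the assignment [G] of truth values to formulas is refuted
   by a binary decision tree of depth [d] that queries formulas of size at most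
   [s] and ends with an instance of a locally inconsistent scheme. *)
Inductive refutation (V : eqType) (s : nat) : nat -> seq (lit V) -> Prop :=
| RefClash d (G : seq (lit V)) (sc : seq (lit nat)) (f g : form V) :
    sc \in schemas -> form_size f <= s -> form_size g <= s ->
    (forall l, l \in sc -> (subst (nth Top [:: f; g]) l.1, l.2) \in G) ->
    refutation s d G
| RefAsk d (G : seq (lit V)) (f : form V) :
    form_size f <= s -> refutation s d ((f, true) :: G) ->
    refutation s d ((f, false) :: G) -> refutation s d.+1 G.

Definition bounded (V : eqType) s (G : seq (lit V)) :=
  forall l : lit V, l \in G -> form_size l.1 <= s.

Definition lit_form V (l : lit V) : form V := if l.2 then l.1 else Neg l.1.

(** Nesting the implications lets a context be extended or discharged one literal at a time; a
    refuted context [G] becomes the theorem [imps G Bot]. *)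
Definition imps V (G : seq (lit V)) (z : form V) : form V :=
  foldr (fun l h => Imp (lit_form l) h) z G.

Lemma subst_comp (U V W : Type) (s : U -> form V) (t : V -> form W) f :
  subst t (subst s f) = subst (fun x => subst t (s x)) f.
Proof. by elim: f => //= [g ->|g -> h ->|g -> h ->|g -> h ->]. Qed.

Lemma form_size_gt0 V (f : form V) : 0 < form_size f.
Proof. by case: f. Qed.

Lemma form_size_subst (U V : Type) (s : U -> form V) M f :
  0 < M -> (forall x, form_size (s x) <= M) ->
  form_size (subst s f) <= form_size f * M.
Proof.
move=> M0 sM; elim: f => /= [x|||g IH|g IHg h IHh|g IHg h IHh|g IHg h IHh];
  by rewrite ?mul1n // mulSn ?mulnDl; have := sM; lia.
Qed.

(** * Derived rules of an arbitrary Frege system *)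

Section Frege.

Variable R : seq rule.

Lemma derivation_cat (V : eqType) G (p q : seq (form V)) :
  derivation R G p -> derivation R G q -> derivation R G (p ++ q).
Proof.
move=> dp; elim=> [|q' f dq IH fG|q' r s dq IH rR pr]; rewrite ?cats0 // -rcons_cat.
  exact: DerHyp.
by apply: DerRule => // g /pr gq; rewrite mem_cat gq orbT.
Qed.

Lemma derivation_catl (V : eqType) G (p q : seq (form V)) :
  derivation R G (p ++ q) -> derivation R G p.
Proof.
elim/last_ind: q => [|q x IH]; rewrite ?cats0 // -rcons_cat => d; apply: IH.
have [t tE] : exists t, t = rcons (p ++ q) x by eexists.
rewrite -tE in d; case: d tE => [|u f du _|u r s du _ _] e.
- by case: (p ++ q) e.
- by case: (rcons_inj e) => <-.
- by case: (rcons_inj e) => <-.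
Qed.

Lemma derivation_subst (V : eqType) (G p : seq (form nat)) (s : nat -> form V) q :
  derivation R G p -> derivation R [::] q -> {in G, forall g, subst s g \in q} ->
  exists q', [/\ derivation R [::] (q ++ q'), {in p, forall f, subst s f \in q ++ q'} &
    proof_size q' <= proof_size (map (subst s) p)].
Proof.
move=> dp dq Gq; elim: dp => [|p' f _ [q' [d i z]] fG|p' r t _ [q' [d i z]] rR pr].
- by exists [::]; rewrite cats0; split=> //; rewrite /proof_size big_nil.
- exists q'; split=> //.
    move=> g; rewrite mem_rcons inE => /orP[/eqP ->|]; last exact: i.
    by rewrite mem_cat Gq.
  by rewrite /proof_size map_rcons -cats1 big_cat /= -/(proof_size _) (leq_trans z) ?leq_addr.
exists (rcons q' (subst s (subst t r.2))); split.
- rewrite -rcons_cat subst_comp; apply: DerRule => // g gr.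
  by rewrite -subst_comp; apply: i; apply: pr.
- move=> g; rewrite -rcons_cat !mem_rcons !inE => /orP[/eqP ->|/i ->]; rewrite ?eqxx ?orbT //.
- by rewrite /proof_size map_rcons -!cats1 !big_cat leq_add.
Qed.

Definition provable (V : eqType) (N : nat) (f : form V) :=
  exists p, [/\ derivation R [::] p, f \in p & proof_size p <= N].

Lemma provable_le (V : eqType) N M (f : form V) : N <= M -> provable N f -> provable M f.
Proof. by move=> NM [p [d i z]]; exists p; split=> //; apply: leq_trans NM. Qed.

Lemma provable_proof_of (V : eqType) N (f : form V) : provable N f ->
  exists p, proof_of R [::] f p /\ proof_size p <= N.
Proof.
case=> p [d i z]; case/splitPr: i d z => p1 p2 d z; exists (rcons p1 f); split.
  split; last by exists p1.
  by apply: (@derivation_catl _ _ _ p2); rewrite cat_rcons.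
by apply: leq_trans z; rewrite -cat_rcons /proof_size big_cat leq_addr.
Qed.

Hypothesis hR : frege_system R.

(** Of the rules in [R] only completeness is known. It supplies one derivation of the schematic
    rule, of some fixed size [c]; substituting formulas of size at most [M] into it costs at most
    [c * M]. All later rules are obtained in this way. *)
Lemma frege_rule (G : seq (form nat)) (f : form nat) : entails G f ->
  exists c, forall (V : eqType) (a : seq (form V)) M N, 0 < M ->
    {in a, forall x, form_size x <= M} ->
    {in G, forall g, provable N (subst (nth Top a) g)} ->
    provable (size G * N + c * M) (subst (nth Top a) f).
Proof.
move=> /(frege_complete hR)[p [dp [q pq]]]; exists (proof_size p) => V a M N M0 aM Gp.
have sM x : form_size (nth Top a x) <= M.
  case: (ltnP x (size a)) => xa; first by apply: aM; apply: mem_nth.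
  by rewrite nth_default.
have [q0 [d0 i0 z0]] : exists q, [/\ derivation R [::] q,
    {in G, forall g, subst (nth Top a) g \in q} & proof_size q <= size G * N].
  elim: {dp} G Gp => [|g G IH] Gp.
    by exists [::]; split=> //; [apply: DerNil|rewrite /proof_size big_nil].
  have [g' g'G|q1 [d1 i1 z1]] := IH; first by apply: Gp; rewrite inE g'G orbT.
  have [q2 [d2 i2 z2]] := Gp g (mem_head _ _).
  exists (q2 ++ q1); split; first exact: derivation_cat.
    by move=> g'; rewrite inE mem_cat => /orP[/eqP ->|/i1 ->]; rewrite ?i2 ?orbT.
  by rewrite /proof_size big_cat /= mulSn leq_add.
have [q' [d' i' z']] := derivation_subst dp d0 i0.
exists (q0 ++ q'); split=> //; first by apply: i'; rewrite pq mem_rcons mem_head.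
rewrite /proof_size big_cat leq_add // (leq_trans z') //.
rewrite /proof_size big_map big_distrl leq_sum // => x _; exact: form_size_subst.
Qed.

Lemma schema_rule sc : sc \in schemas -> entails [::] (imps sc (Var 2)).
Proof.
move=> scs v _; move: scs; rewrite !inE.
by do ! case/orP; move/eqP => -> /=; case: (v 0); case: (v 1); case: (v 2).
Qed.

Lemma subst_imps V (a : seq (form V)) sc z :
  subst (nth Top a) (imps sc z)
  = imps [seq (subst (nth Top a) l.1, l.2) | l <- sc] (subst (nth Top a) z).
Proof. by elim: sc => //= -[f []] sc /= ->. Qed.

Lemma imps_cat V (G H : seq (lit V)) z : imps (G ++ H) z = imps G (imps H z).
Proof. by rewrite /imps foldr_cat. Qed.

Lemma size_lit_form V (l : lit V) : form_size (lit_form l) <= (form_size l.1).+1.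
Proof. by case: l => f []. Qed.

Lemma size_lit_imps (V : eqType) (G : seq (lit V)) l z :
  l \in G -> form_size (lit_form l) <= form_size (imps G z).
Proof.
elim: G => //= l' G IH; rewrite inE => /orP[/eqP ->|/IH]; lia.
Qed.

Lemma size_imps (V : eqType) s (G : seq (lit V)) :
  bounded s (G) -> form_size (imps G Bot) <= size G * (s + 2) + 1.
Proof.
elim: G => // l G IH Gs /=; have ls := Gs l (mem_head _ _).
have {IH} : form_size (imps G Bot) <= size G * (s + 2) + 1.
  by apply: IH => x xG; apply: Gs; rewrite inE xG orbT.
have := size_lit_form l; rewrite mulSn.  lia.
Qed.

Lemma mp_rule : exists c, forall (V : eqType) (f g : form V) M N, 0 < M ->
  form_size f <= M -> form_size g <= M -> provable N (Imp f g) -> provable N f ->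
  provable (2 * N + c * M) g.
Proof.
have [|c cP] := @frege_rule [:: Imp (Var 0) (Var 1); Var 0] (Var 1).
  move=> v h; have := h _ (mem_head _ _).
  by have := h (Var 0); rewrite !inE eqxx orbT => /(_ isT) /= ->.
exists c => V f g M N M0 fM gM pfg pf; apply: (cP V [:: f; g]) => //.
  by move=> x; rewrite !inE => /orP[] /eqP ->.
by move=> x; rewrite !inE => /orP[] /eqP ->.
Qed.

(** Contraction of a repeated literal. One rule treats the occurrence at the head, another carries
    the contraction below one more premise, so the cost is linear in the distance to the
    occurrence. *)
Lemma absorb_rule : exists c, forall (V : eqType) (l : lit V) (G : seq (lit V)) M,
  l \in G -> form_size (imps G Bot) <= M ->
  provable (c * size G * M) (Imp (Imp (lit_form l) (imps G Bot)) (imps G Bot)).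
Proof.
have [|c1 c1P] := @frege_rule [::] (Imp (Imp (Var 0) (Imp (Var 0) (Var 1)))
    (Imp (Var 0) (Var 1))).
  by move=> v _ /=; case: (v 0); case: (v 1).
have [|c2 c2P] := @frege_rule [:: Imp (Imp (Var 0) (Var 1)) (Var 1)]
   (Imp (Imp (Var 0) (Imp (Var 2) (Var 1))) (Imp (Var 2) (Var 1))).
  move=> v h; have := h _ (mem_head _ _) => /=.
  by case: (v 0); case: (v 1); case: (v 2).
exists (c1 + c2) => V l G M lG; elim: G lG => // l' G IH; rewrite inE => lG GM.
have GM' : form_size (imps G Bot) <= M by move: GM => /=; lia.
have lM : form_size (lit_form l') <= M by move: GM => /=; lia.
have M0 : 0 < M by apply: leq_trans GM'; apply: form_size_gt0.
case: (altP (l =P l')) => [->|ll'].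
  apply: (@provable_le _ (0 * 0 + c1 * M)); first by rewrite /= mulnS mulnDl; lia.
  apply: (c1P V [:: lit_form l'; imps G Bot]) => // x.
  by rewrite !inE => /orP[] /eqP ->.
rewrite (negbTE ll') /= in lG; have {}IH := IH lG GM'.
apply: (@provable_le _ (1 * ((c1 + c2) * size G * M) + c2 * M)).
  by rewrite /= mulnS !mulnDl; lia.
apply: (c2P V [:: lit_form l; imps G Bot; lit_form l']) => // x.
  rewrite !inE => /or3P[] /eqP -> //.
  by apply: leq_trans (size_lit_imps Bot lG) _.
by rewrite !inE => /eqP ->.
Qed.

(** Each scheme is inconsistent, so it implies anything; [Var 2] stands for that conclusion. The
    constants of the finitely many schemes are added up. *)
Lemma schemas_rule : exists c, forall (V : eqType) (sc : seq (lit nat)) (f g z : form V) M,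
  sc \in schemas -> form_size f <= M -> form_size g <= M -> form_size z <= M ->
  provable (c * M) (imps [seq (subst (nth Top [:: f; g]) l.1, l.2) | l <- sc] z).
Proof.
have sub : {subset schemas <= schemas} by [].
elim: {-2}schemas sub => [|sc scs IH] sub; first by exists 0.
have [sc' h|c1 c1P] := IH; first by apply: sub; rewrite inE h orbT.
have [c2 c2P] := frege_rule (schema_rule (sub sc (mem_head _ _))).
exists (c1 + c2) => V sc' f g z M; rewrite inE mulnDl => /orP[/eqP ->|sin] fM gM zM.
  apply: (@provable_le _ (0 * 0 + c2 * M)); first lia.
  have M0 : 0 < M by apply: leq_trans fM; apply: form_size_gt0.
  have -> : [seq (subst (nth Top [:: f; g]) l.1, l.2) | l <- sc]
          = [seq (subst (nth Top [:: f; g; z]) l.1, l.2) | l <- sc].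
    have := sub sc (mem_head _ _); rewrite !inE.
    by do ! case/orP; move/eqP => ->.
  rewrite -[z in imps _ z]/(subst (nth Top [:: f; g; z]) (Var 2)) -subst_imps.
  apply: c2P => // x; rewrite !inE => /or3P[] /eqP -> //.
by apply: provable_le (c1P V sc' f g z M sin fM gM zM); rewrite leq_addr.
Qed.

(** A query is a case distinction between two subproofs, and [2 ^ d.+1 - 1] bounds the number of
    nodes. Along a branch the context grows as the remaining depth shrinks, so one [L] bounds
    [size G + d] throughout. *)
Lemma refutation_provable : exists c, forall (V : eqType) s d (G : seq (lit V)) L,
  refutation s d G -> bounded s (G) -> size G + d <= L ->
  provable ((2 ^ d.+1 - 1) * (c * (L + 4) ^ 2 * (s + 2))) (imps G Bot).
Proof.
have [c1 c1P] := mp_rule; have [c2 c2P] := absorb_rule; have [c3 c3P] := schemas_rule.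
have [|c4 c4P] := @frege_rule [:: Imp (Var 0) (Var 1); Imp (Neg (Var 0)) (Var 1)] (Var 1).
  move=> v h; have := h _ (mem_head _ _).
  by have := h (Imp (Neg (Var 0)) (Var 1)); rewrite !inE eqxx orbT => /(_ isT) /=; case: (v 0).
pose c := 16 * (c1 + c2 + c3) + c4; exists c => V s d G L r Gs.
pose M := (L + 4) * (s + 2).
have hM a : a <= L + 3 -> a * (s + 2) + 1 <= M by rewrite /M; nia.
elim: {d G}r Gs => [d G sc f g scs fs gs cl|d G f fs _ IH1 _ IH2] Gs GL.
  set ls := [seq (subst (nth Top [:: f; g]) l.1, l.2) | l <- sc] in cl.
  have lsG : {subset ls <= G} by move=> _ /mapP[l lsc ->]; apply: cl.
  have ls3 : size ls <= 3.
    by rewrite size_map; move: scs; rewrite !inE; do ! case/orP; move/eqP => ->.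
  have GM : form_size (imps G Bot) <= M.
    by apply: leq_trans (size_imps Gs) _; rewrite /M; nia.
  have base : provable (c3 * M) (imps ls (imps G Bot)).
    by apply: c3P => //; [apply: leq_trans fs _|apply: leq_trans gs _]; rewrite /M; nia.
  (* The literals of the scheme instance already occur in [G], so they are absorbed one by one; the
     size bound doubles each time, and there are at most three of them. *)
  have step ls' N : {subset ls' <= G} -> size ls' <= 3 -> provable N (imps ls' (imps G Bot)) ->
      provable (2 ^ size ls' * N + (2 ^ size ls' - 1) * ((c1 + 2 * c2 * (L + 4)) * M)) (imps G Bot).
    elim: ls' N => [|l ls' IH] N sub l3 pN.
      by apply: provable_le pN; rewrite /= expn0 mul1n subnn mul0n addn0.
    have lG : l \in ls' ++ G by rewrite mem_cat (sub l (mem_head _ _)) orbT.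
    have sub' : {subset ls' <= G} by move=> x xl; apply: sub; rewrite inE xl orbT.
    have szs : size (l :: ls' ++ G) <= L + 3 by move: l3; rewrite /= size_cat; lia.
    have allG : bounded s (l :: ls' ++ G).
      by move=> x; rewrite -cat_cons mem_cat => /orP[/sub|]; apply: Gs.
    have big : form_size (imps (l :: ls' ++ G) Bot) <= M.
      exact: leq_trans (size_imps allG) (hM _ szs).
    have small : form_size (imps (ls' ++ G) Bot) <= M by move: big => /=; lia.
    have pa := c2P V l _ M lG small.
    pose K := (c1 + 2 * c2 * (L + 4)) * M.
    have := IH (2 * N + K) sub' (ltnW l3).
    have -> : 2 ^ size ls' * (2 * N + K) + (2 ^ size ls' - 1) * K =
        2 ^ size (l :: ls') * N + (2 ^ size (l :: ls') - 1) * K.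
      by rewrite /= expnS; have := expn_gt0 2 (size ls'); nia.
    move=> h; apply: h; rewrite -imps_cat;
      apply: (@provable_le _ (2 * (N + c2 * (L + 4) * M) + c1 * M)).
      by rewrite /K; nia.
    have M0 : 0 < M by apply: leq_trans small; apply: form_size_gt0.
    apply: (c1P V (Imp (lit_form l) (imps (ls' ++ G) Bot)) _ _ _ M0 big small).
      apply: provable_le pa; apply: leq_trans (leq_addl _ _).
      by rewrite leq_mul2r leq_mul2l; move: szs => /=; lia.
    by rewrite imps_cat; apply: provable_le pN; apply: leq_addr.
  have {}step := step ls _ lsG ls3 base; apply: provable_le step.
  have h2 : 1 <= 2 ^ d.+1 - 1 by have := expn_gt0 2 d; rewrite expnS; lia.
  apply: (@leq_trans (1 * (c * (L + 4) ^ 2 * (s + 2)))); last by rewrite leq_mul2r h2 orbT.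
  have h3 : 2 ^ size ls <= 8 by rewrite (@leq_pexp2l 2 _ 3).
  rewrite mul1n expnSr expn1 /c -!mulnA -/M.
  set m := 2 ^ size ls in h3 *; nia.
have fGs b : {in (f, b) :: G, forall l, form_size l.1 <= s}.
  by move=> l; rewrite inE => /orP[/eqP ->|/Gs].
have p1 := IH1 (fGs true) ltac:(by rewrite /= addSnnS).
have p2 := IH2 (fGs false) ltac:(by rewrite /= addSnnS).
have M0 : 0 < M by rewrite /M; lia.
have GM : form_size (imps G Bot) <= M.
  by apply: leq_trans (size_imps Gs) _; rewrite /M; nia.
have fM : form_size f <= M by apply: leq_trans fs _; rewrite /M; nia.
set B := (2 ^ d.+1 - 1) * _ in p1 p2.
apply: (@provable_le _ (2 * B + c4 * M)); last first.
  apply: (c4P V [:: f; imps G Bot]) => // x; rewrite !inE => /orP[] /eqP -> //.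
have h : c4 * M <= c * (L + 4) ^ 2 * (s + 2).
  rewrite /c; rewrite expnS expn1 /M; nia.
rewrite /B; have := expn_gt0 2 d; rewrite [2 ^ d.+2]expnS expnS; nia.
Qed.

Lemma refutation_proof : exists c, forall (V : eqType) s d (f : form V),
  refutation s d [:: (f, false)] -> form_size f <= s ->
  exists p, proof_of R [::] f p /\
    proof_size p <= c * (2 ^ d.+1 * (d + 5) ^ 2 * (s + 2)).
Proof.
have [c1 c1P] := refutation_provable.
have [|c2 c2P] := @frege_rule [:: Imp (Neg (Var 0)) Bot] (Var 0).
  by move=> v h; have := h _ (mem_head _ _) => /=; case: (v 0).
exists (c1 + c2) => V s d f r fs; apply: provable_proof_of.
have fG : {in [:: (f, false)], forall l, form_size l.1 <= s}.
  by move=> l; rewrite inE => /eqP ->.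
have p := c1P V s d _ (1 + d) r fG (leqnn _).
apply: provable_le (c2P V [:: f] s _ (leq_trans (form_size_gt0 f) fs) _ _); last first.
- by move=> g; rewrite inE => /eqP -> /=; exact: p.
- by move=> x; rewrite inE => /eqP ->.
have -> : 1 + d + 4 = d + 5 by lia.
rewrite mulnDl mul1n; apply: leq_add.
  apply: (@leq_trans (2 ^ d.+1 * (c1 * (d + 5) ^ 2 * (s + 2)))); last by lia.
  by rewrite leq_mul2r leq_subr orbT.
rewrite leq_mul2l; apply/orP; right.
have e1 := expn_gt0 2 d.+1; have e2 : 0 < (d + 5) ^ 2 by rewrite expn_gt0; lia.
have e3 : 0 < 2 ^ d.+1 * (d + 5) ^ 2 by rewrite muln_gt0 e1 e2.
by apply: (@leq_trans (1 * (s + 2))); [lia|rewrite leq_mul2r e3 orbT].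
Qed.

End Frege.

(** * Querying disjunctions and conjunctions *)

Section Queries.

Variables (V : eqType) (s : nat).
Implicit Types (G : seq (lit V)) (f g : form V) (l : seq (form V)).

(* The context is taken to be bounded, so that subformulas of its formulas can be
   queried without a size condition. *)
Definition ref d G := bounded s G -> refutation s d G.

Lemma ref_weaken d d' G G' : d <= d' -> {subset G <= G'} -> ref d G -> ref d' G'.
Proof.
move=> dd GG r bG'; have {}r : refutation s d G by apply: r => x xG; apply: bG'; apply: GG.
elim: r d' G' dd GG {bG'} => {d G} [d G sc f g scs fs gs cl|d G f fs _ IH1 _ IH2] d' G' dd GG.
  by apply: (RefClash _ scs fs gs) => l /cl /GG.
case: d' dd => // d' dd.
have ext b : {subset (f, b) :: G <= (f, b) :: G'}.
  by move=> l; rewrite !inE => /orP[->//|/GG ->]; rewrite orbT.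
by apply: (RefAsk fs); [apply: IH1|apply: IH2].
Qed.

Lemma ref_le d d' G : d <= d' -> ref d G -> ref d' G.
Proof. by move=> dd; apply: ref_weaken. Qed.

Lemma ask f d G : form_size f <= s ->
  ref d ((f, true) :: G) -> ref d ((f, false) :: G) -> ref d.+1 G.
Proof.
move=> fs r1 r2 bG.
by apply: (RefAsk fs); [apply: r1|apply: r2] => l; rewrite inE => /orP[/eqP ->|/bG].
Qed.

Lemma ref_bound d G f b : (f, b) \in G -> (form_size f <= s -> ref d G) -> ref d G.
Proof. by move=> fG r bG; apply: r => //; apply: bG fG. Qed.

Lemma clashI sc f g d G : sc \in schemas -> form_size f <= s -> form_size g <= s ->
  all (fun x => (subst (nth Top [:: f; g]) x.1, x.2) \in G) sc -> refutation s d G.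
Proof. by move=> scs fs gs /allP; apply: RefClash. Qed.

Let x := @Var nat 0.
Let y := @Var nat 1.

Lemma clash_id d G f : (f, true) \in G -> (f, false) \in G -> ref d G.
Proof.
move=> h1 h2 bG; have fs := bG _ h1.
by apply: (@clashI [:: (x, true); (x, false)] f f) => //=; rewrite h1 h2.
Qed.

Lemma clash_bot d G : (Bot, true) \in G -> ref d G.
Proof.
move=> h bG; have fs := bG _ h.
by apply: (@clashI [:: (Bot, true)] Bot Bot) => //=; rewrite h.
Qed.

Lemma neg_query d G f b : (Neg f, b) \in G -> ref d ((f, ~~ b) :: G) -> ref d.+1 G.
Proof.
move=> h r bG; have fs : form_size f < s := bG _ h; move: bG; apply: (@ask f); first exact: ltnW.
  case: b h r => h r; last exact: r.
  move=> _; apply: (@clashI [:: (Neg x, true); (x, true)] f f); rewrite ?(ltnW fs) //=.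
  by rewrite !inE eqxx h !orbT.
case: b h r => h r; first exact: r.
move=> _; apply: (@clashI [:: (Neg x, false); (x, false)] f f); rewrite ?(ltnW fs) //=.
by rewrite !inE eqxx h !orbT.
Qed.

Lemma clash_neg d G f b : (Neg f, b) \in G -> (f, b) \in G -> ref d G.
Proof.
move=> h h' bG; have fs : form_size f <= s := bG _ h'; case: b h h' => h h'.
  by apply: (@clashI [:: (Neg x, true); (x, true)] f f) => //=; rewrite h h'.
by apply: (@clashI [:: (Neg x, false); (x, false)] f f) => //=; rewrite h h'.
Qed.

Lemma and_query d G f g : (And f g, true) \in G ->
  ref d ((f, true) :: (g, true) :: G) -> ref d.+2 G.
Proof.
move=> h r bG; have /= fgs := bG _ h.
have fs : form_size f <= s by lia.
have gs : form_size g <= s by lia.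
move: bG; apply: (@ask g) => //.
  apply: (@ask f) => // _; apply: (@clashI [:: (And x y, true); (x, false)] f g) => //=.
  by rewrite !inE eqxx h !orbT.
move=> _; apply: (@clashI [:: (And x y, true); (y, false)] f g) => //=.
by rewrite !inE eqxx h !orbT.
Qed.

Lemma clash_and d G f g : (And f g, false) \in G ->
  (f, true) \in G -> (g, true) \in G -> ref d G.
Proof.
move=> h hf hg bG; have fs := bG _ hf; have gs := bG _ hg.
by apply: (@clashI [:: (And x y, false); (x, true); (y, true)] f g) => //=; rewrite h hf hg.
Qed.

Lemma clash_andr d G f g b : (And f g, true) \in G ->
  ((if b then f else g), false) \in G -> ref d G.
Proof.
move=> h hf bG; have /= fgs := bG _ h.
have fs : form_size f <= s by lia.
have gs : form_size g <= s by lia.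
case: b hf => hf.
  by apply: (@clashI [:: (And x y, true); (x, false)] f g) => //=; rewrite h hf.
by apply: (@clashI [:: (And x y, true); (y, false)] f g) => //=; rewrite h hf.
Qed.

Lemma clash_or d G f g : (Or f g, true) \in G ->
  (f, false) \in G -> (g, false) \in G -> ref d G.
Proof.
move=> h hf hg bG; have fs := bG _ hf; have gs := bG _ hg.
by apply: (@clashI [:: (Or x y, true); (x, false); (y, false)] f g) => //=; rewrite h hf hg.
Qed.

Lemma clash_orr d G f g b : (Or f g, false) \in G ->
  ((if b then f else g), true) \in G -> ref d G.
Proof.
move=> h hf bG; have /= fgs := bG _ h.
have fs : form_size f <= s by lia.
have gs : form_size g <= s by lia.
case: b hf => hf.
  by apply: (@clashI [:: (Or x y, false); (x, true)] f g) => //=; rewrite h hf.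
by apply: (@clashI [:: (Or x y, false); (y, true)] f g) => //=; rewrite h hf.
Qed.

Lemma imp_query d G f g : (Imp f g, false) \in G ->
  ref d ((f, true) :: (g, false) :: G) -> ref d.+2 G.
Proof.
move=> h r bG; have /= fgs := bG _ h.
have fs : form_size f <= s by lia.
have gs : form_size g <= s by lia.
move: bG; apply: (@ask g) => //.
  move=> _; apply: (@clashI [:: (Imp x y, false); (y, true)] f g) => //=.
  by rewrite !inE eqxx h !orbT.
apply: (@ask f) => // _; apply: (@clashI [:: (Imp x y, false); (x, false)] f g) => //=.
by rewrite !inE eqxx h !orbT.
Qed.

(* Binary search for a position where the value of [P] changes. *)
Lemma chain_query (P : nat -> form V) c d e a b G : a <= b -> b <= a + 2 ^ e ->
  (forall j, a <= j <= b -> form_size (P j) <= s) ->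
  (P a, c) \in G -> (P b, ~~ c) \in G ->
  (forall j, a <= j < b -> ref d ((P j, c) :: (P j.+1, ~~ c) :: G)) ->
  ref (d + e) G.
Proof.
elim: e a b G => [|e IH] a b G ab be Ps Pa Pb cont.
  have [ab'|ab'] : a = b \/ b = a.+1 by move: be; rewrite expn0; lia.
    by rewrite -ab' in Pb; case: c Pa Pb {cont} => h1 h2; apply: clash_id; eassumption.
  rewrite addn0 ab' in Pb *; apply: ref_weaken (leqnn d) _ (cont a _); last lia.
  by move=> l; rewrite !inE => /or3P[/eqP ->|/eqP ->|].
case: (leqP b (a + 2 ^ e)) => be'.
  by apply: ref_le (IH a b G ab be' Ps Pa Pb cont); rewrite leq_add2l.
pose m := a + 2 ^ e; rewrite addnS.
have key v : ref (d + e) ((P m, v) :: G).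
  have ext j : a <= j < b -> ref d ((P j, c) :: (P j.+1, ~~ c) :: (P m, v) :: G).
    move=> /cont; apply: ref_weaken => // l.
    by rewrite !inE => /or3P[/eqP ->|/eqP ->|->]; rewrite ?eqxx ?orbT.
  have mb : m <= b by apply: ltnW.
  have am : a <= m by apply: leq_addr.
  case: (altP (v =P c)) => [vc|vc].
    apply: (IH m b) => //.
    - by move: be; rewrite expnS /m; lia.
    - by move=> j /andP[mj jb]; apply: Ps; rewrite (leq_trans am mj).
    - by rewrite vc mem_head.
    - by rewrite inE Pb orbT.
    - by move=> j /andP[mj jb]; apply: ext; rewrite (leq_trans am mj).
  have {}vc : v = ~~ c by case: v vc {ext}; case: (c).
  apply: (IH a m) => //.
  - by move=> j /andP[aj jm]; apply: Ps; rewrite aj (leq_trans jm mb).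
  - by rewrite inE Pa orbT.
  - by rewrite vc mem_head.
  - by move=> j /andP[aj jm]; apply: ext; rewrite aj (leq_trans jm mb).
by apply: (@ask (P m)) => //; apply: Ps; rewrite leq_addr (ltnW be').
Qed.

Lemma size_or f g : form_size (Or f g) = (form_size f + form_size g).+1.
Proof. by []. Qed.

Lemma size_and f g : form_size (And f g) = (form_size f + form_size g).+1.
Proof. by []. Qed.

Lemma big_or_cons f l : big_or (f :: l) = if l is [::] then f else Or f (big_or l).
Proof. by case: l. Qed.

Lemma big_and_cons f l : big_and (f :: l) = if l is [::] then f else And f (big_and l).
Proof. by case: l. Qed.

Lemma size_big_or_drop l j : form_size (big_or (drop j l)) <= form_size (big_or l).
Proof.
elim: l j => // f l IH [|j] //=; rewrite -/(big_or (f :: l)) big_or_cons.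
apply: leq_trans (IH j) _; case: l {IH} => [|g l]; first exact: form_size_gt0.
by rewrite size_or; lia.
Qed.

Lemma size_big_or_mem l f : f \in l -> form_size f <= form_size (big_or l).
Proof.
elim: l => // g [|h l] IH; first by rewrite inE => /eqP ->.
by rewrite inE big_or_cons size_or => /orP[/eqP ->|/IH]; lia.
Qed.

Lemma size_big_or_take l j : form_size (big_or (take j l)) <= form_size (big_or l).
Proof.
elim: l j => // f l IH [|j]; first exact: form_size_gt0.
case: l IH => [|g l] IH; first by [].
have := IH j; rewrite [take j.+1 _]/= [big_or [:: f, g & l]]big_or_cons size_or.
by case: (take j _) => [|h t]; rewrite [big_or [:: f & _]]big_or_cons ?size_or; lia.
Qed.

(** Finding a true disjunct among [2 ^ e] takes about [e] queries: some suffix of the list is true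
    while the next one is false, and the position is found by bisection. *)
Lemma or_query d e l G : size l <= 2 ^ e -> (big_or l, true) \in G ->
  {in l, forall f, ref d ((f, true) :: G)} -> ref (d + e + 2) G.
Proof.
move=> le lG cont; apply: (ref_bound lG) => ls.
have s0 : 0 < s by apply: leq_trans ls; apply: form_size_gt0.
(* [Bot] is the disjunction of the empty suffix and serves as the false end of the chain. *)
rewrite addn2; apply: (@ask Bot) => //; first by apply: clash_bot; rewrite mem_head.
rewrite -addSn; apply: (@chain_query (fun j => big_or (drop j l)) true _ _ 0 (size l)) => //.
- by move=> j _; apply: leq_trans ls; apply: size_big_or_drop.
- by rewrite drop0 inE lG orbT.
- by rewrite drop_size mem_head.
move=> j /andP[_ jl]; rewrite (drop_nth Bot jl) big_or_cons.
have fl := mem_nth Bot jl; set f := nth Bot l j in fl *.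
have w : ref d ((f, true) :: G) by apply: cont.
apply: (@ask f); first by apply: leq_trans ls; apply: size_big_or_mem.
  apply: ref_weaken w => // z; rewrite !inE => /orP[->|->]; rewrite ?orbT //.
case: (drop j.+1 l) => [|g r].
  by apply: (@clash_id _ _ f); rewrite !inE eqxx ?orbT.
by apply: (@clash_or _ _ f (big_or (g :: r))); rewrite !inE eqxx ?orbT.
Qed.

Lemma or_intro d e l f G : size l <= 2 ^ e -> (big_or l, false) \in G -> f \in l ->
  (f, true) \in G -> e < d -> ref d G.
Proof.
move=> le lG fl fG ed; apply: (ref_bound lG) => ls.
have s0 : 0 < s by apply: leq_trans ls; apply: form_size_gt0.
pose j := index f l; have jl : j < size l by rewrite index_mem.
have fE : nth Bot l j = f by apply: nth_index.
apply: (@ref_le (0 + e).+1) => //; apply: (@ask (big_or (drop j l))).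
- by apply: leq_trans ls; apply: size_big_or_drop.
- apply: (@chain_query (fun j => big_or (drop j l)) false _ _ 0 j) => //.
  + by apply: leq_trans le; apply: ltnW.
  + by move=> i _; apply: leq_trans ls; apply: size_big_or_drop.
  + by rewrite drop0 inE lG orbT.
  + by rewrite mem_head.
  move=> i /andP[_ ij]; have il := ltn_trans ij jl; rewrite (drop_nth Bot il) big_or_cons.
  case: (drop i.+1 l) => [|g r]; first by apply: clash_bot; rewrite !inE eqxx ?orbT.
  by apply: (@clash_orr _ _ (nth Bot l i) (big_or (g :: r)) false); rewrite !inE eqxx ?orbT.
rewrite (drop_nth Bot jl) big_or_cons fE.
case: (drop j.+1 l) => [|g r].
  by apply: (@clash_id _ _ f); rewrite !inE ?fG ?eqxx ?orbT.
by apply: (@clash_orr _ _ f (big_or (g :: r)) true); rewrite !inE ?fG ?eqxx ?orbT.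
Qed.

Lemma or_false d e l f G : size l <= 2 ^ e -> (big_or l, false) \in G -> f \in l ->
  ref d ((f, false) :: G) -> ref (d + e + 2) G.
Proof.
move=> le lG fl cont; apply: (ref_bound lG) => ls.
rewrite addn2; apply: (@ask f); first by apply: leq_trans ls; apply: size_big_or_mem.
  apply: (@or_intro _ e l f) => //; rewrite ?mem_head ?inE ?lG ?orbT //; lia.
by apply: ref_le cont; lia.
Qed.

Lemma size_big_and_drop l j : form_size (big_and (drop j l)) <= form_size (big_and l).
Proof.
elim: l j => // f l IH [|j] //=; rewrite -/(big_and (f :: l)) big_and_cons.
apply: leq_trans (IH j) _; case: l {IH} => [|g l]; first exact: form_size_gt0.
by rewrite size_and; lia.
Qed.

Lemma and_true d e l f G : size l <= 2 ^ e -> (big_and l, true) \in G -> f \in l ->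
  ref d ((f, true) :: G) -> ref (d + e + 2) G.
Proof.
move=> le lG fl cont; apply: (ref_bound lG) => ls.
pose j := index f l; have jl : j < size l by rewrite index_mem.
have fE : nth Bot l j = f by apply: nth_index.
have js := leq_trans (size_big_and_drop l j) ls.
have fs : form_size f <= s.
  by move: js; rewrite (drop_nth Bot jl) fE; case: drop => // g r; rewrite big_and_cons size_and; lia.
rewrite addn2; apply: (@ask f) => //; first by apply: ref_le cont; lia.
apply: (@ask (big_and (drop j l))) => //.
  rewrite (drop_nth Bot jl) big_and_cons fE.
  case: (drop j.+1 l) => [|g r]; first by apply: (@clash_id _ _ f); rewrite !inE ?eqxx ?orbT.
  by apply: (@clash_andr _ _ f (big_and (g :: r)) true); rewrite !inE eqxx ?orbT.
rewrite addnC; apply: ref_le (leq_addr d e) _.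
apply: (@chain_query (fun j => big_and (drop j l)) true 0 e 0 j) => //.
- by apply: leq_trans le; apply: ltnW.
- by move=> i _; apply: leq_trans ls; apply: size_big_and_drop.
- by rewrite drop0 !inE lG !orbT.
- by rewrite mem_head.
move=> i /andP[_ ij]; have il := ltn_trans ij jl; rewrite (drop_nth Bot il) big_and_cons.
have : drop i.+1 l != [::] by rewrite -size_eq0 size_drop subn_eq0 -ltnNge (leq_ltn_trans ij jl).
case: (drop i.+1 l) => [//|g r] _.
by apply: (@clash_andr _ _ (nth Bot l i) (big_and (g :: r)) false); rewrite !inE eqxx ?orbT.
Qed.

(** The disjunct [j] holds and all earlier ones fail. This replaces an arbitrary choice by a
    canonical one: at most one [j] can qualify. *)
Definition first l j := And (nth Bot l j) (Neg (big_or (take j l))).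

Lemma first_nth d l j G : (first l j, true) \in G ->
  ref d ((nth Bot l j, true) :: G) -> ref d.+1 G.
Proof.
move=> h r; apply: (ref_bound h) => /= hs; apply: (@ask (nth Bot l j)) => //; first lia.
apply: (@clash_andr _ _ (nth Bot l j) (Neg (big_or (take j l))) true); rewrite ?mem_head //.
by rewrite inE h orbT.
Qed.

Lemma first_or d e l j G : size l <= 2 ^ e -> (first l j, true) \in G -> j < size l ->
  (big_or l, false) \in G -> e + 1 < d -> ref d G.
Proof.
move=> le h jl lG ed; apply: (@ref_le (e + 1).+1) => //; apply: (first_nth h).
apply: (@or_intro _ e l (nth Bot l j)); rewrite ?inE ?lG ?eqxx ?orbT ?mem_nth //.
lia.
Qed.

Lemma first_unique d e l j j' G : size l <= 2 ^ e -> j < size l -> j' < size l ->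
  j != j' -> (first l j, true) \in G -> (first l j', true) \in G -> e + 4 < d -> ref d G.
Proof.
wlog jj' : j j' / j < j'.
  move=> H le jl jl' ne h h'; case: (ltngtP j j') ne => // jj _.
    by apply: (H j j') => //; rewrite neq_ltn jj.
  by apply: (H j' j) => //; rewrite eq_sym neq_ltn jj orbT.
move=> le jl jl' _ h h' ed; apply: (@ref_le (e + 1).+4); first lia.
apply: (and_query h'); apply: (@neg_query _ _ (big_or (take j' l)) true).
  by rewrite !inE eqxx ?orbT.
apply: (@first_nth _ l j); first by rewrite !inE h !orbT.
apply: (@or_intro _ e (take j' l) (nth Bot l j)); rewrite ?inE ?eqxx ?orbT //; last lia.
  by apply: leq_trans le; rewrite size_take_min geq_minr.
by rewrite -(nth_take Bot jj') mem_nth // size_takel // ltnW.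
Qed.

(** Here the bisection runs over prefixes: where the disjunction of a prefix turns true, the
    disjunct just added is the first true one. *)
Lemma min_query d e l G : size l <= 2 ^ e -> (big_or l, true) \in G ->
  (forall j, j < size l -> form_size (first l j) <= s) ->
  (forall j, j < size l -> ref d ((first l j, true) :: G)) -> ref (d + 3 * e + 9) G.
Proof.
move=> le lG fs cont; apply: (ref_bound lG) => ls.
have s0 : 0 < s by apply: leq_trans ls; apply: form_size_gt0.
apply: (@ref_le (d + 2 * e + 8 + e).+1); first lia.
apply: (@ask Bot) => //; first by apply: clash_bot; rewrite mem_head.
apply: (@chain_query (fun j => big_or (take j l)) false _ _ 0 (size l)) => //.
- by move=> j _; apply: leq_trans ls; apply: size_big_or_take.
- by rewrite take0 mem_head.
- by rewrite take_size inE lG orbT.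
move=> j /andP[_ jl].
apply: (@ref_le ((d + e + 6) + e + 2)); first lia.
apply: (@or_query _ e (take j.+1 l)).
- by apply: leq_trans le; rewrite size_takel.
- by rewrite !inE eqxx ?orbT.
move=> f; rewrite (take_nth Bot jl) mem_rcons inE => /orP[/eqP ->|fj]; last first.
  apply: (@or_intro _ e (take j l) f); rewrite ?inE ?eqxx ?orbT //; last lia.
  by apply: leq_trans le; rewrite size_takel // ltnW.
apply: (@ref_le (d + 2).+1); first lia.
apply: (@ask (first l j)); first exact: fs.
  by apply: ref_weaken (cont j jl); [lia|move=> z; rewrite !inE => /orP[->|->]; rewrite ?orbT].
rewrite addn2; apply: (@ask (Neg (big_or (take j l)))).
- by have := fs j jl; rewrite /first /=; lia.
- by apply: (@clash_and _ _ (nth Bot l j) (Neg (big_or (take j l)))); rewrite !inE eqxx ?orbT.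
by apply: (@clash_neg _ _ (big_or (take j l)) false); rewrite !inE eqxx ?orbT.
Qed.

End Queries.

(** * Counting *)

Inductive tree (V : Type) := Lf of form V | Nd of tree V & tree V.

(* [ex t j]: exactly [j] leaves of [t] are true. *)
Fixpoint ex (V : Type) (t : tree V) (j : nat) : form V :=
  match t with
  | Lf f => if j is 0 then Neg f else if j is 1 then f else Bot
  | Nd l r => big_or [seq And (ex l i) (ex r (j - i)) | i <- iota 0 j.+1]
  end.

Fixpoint leaves (V : Type) (t : tree V) : nat :=
  if t is Nd l r then leaves l + leaves r else 1.

Fixpoint height (V : Type) (t : tree V) : nat :=
  if t is Nd l r then (maxn (height l) (height r)).+1 else 0.

Definition some_value (V : Type) (t : tree V) : form V :=
  big_or [seq ex t j | j <- iota 0 (leaves t).+1].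

Fixpoint mk (V : Type) (h : nat) (g : nat -> tree V) : tree V :=
  if h is h'.+1 then Nd (mk h' g) (mk h' (fun i => g (2 ^ h' + i))) else g 0.

(** The summands are trees themselves, so that sums can be iterated; positions from [n] to [2 ^ h]
    are padded with summands of value 0. *)
Definition sum_tree (V : Type) (h n : nat) (g : 'I_n -> tree V) : tree V :=
  mk h (fun i => if insub i is Some x then g x else Lf Bot).

Section Counting.

Variables (V : eqType) (s e : nat).
Implicit Types (G : seq (lit V)) (t : tree V).

Fixpoint sound t : Prop :=
  [/\ leaves t < 2 ^ e, form_size (some_value t) <= s &
      if t is Nd l r then sound l /\ sound r else True].

Lemma sound_leaves t : sound t -> leaves t < 2 ^ e.
Proof. by case: t => [f|l r] []. Qed.

Lemma sound_size t : sound t -> form_size (some_value t) <= s.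
Proof. by case: t => [f|l r] []. Qed.

Lemma ex_node d l r c G : c < 2 ^ e -> (ex (Nd l r) c, true) \in G ->
  (forall i j, i + j = c -> ref s d ((ex l i, true) :: (ex r j, true) :: G)) ->
  ref s (d + e + 4) G.
Proof.
move=> ce h cont; apply: (@ref_le _ _ (d.+2 + e + 2)); first lia.
apply: (or_query _ h); first by rewrite size_map size_iota.
move=> f /mapP[i]; rewrite mem_iota add0n ltnS => ic ->.
apply: (and_query (mem_head _ _)); apply: ref_weaken (cont i (c - i) _) => //.
  by move=> z; rewrite !inE => /or3P[/eqP ->|/eqP ->|->]; rewrite ?eqxx ?orbT.
by rewrite subnKC.
Qed.

Lemma ex_leaf d f j G : (ex (Lf f) j, true) \in G ->
  (j <= 1 -> ref s d ((f, j == 1) :: G)) -> ref s d.+1 G.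
Proof.
case: j => [|[|j]] h cont.
- by apply: (neg_query h); apply: cont.
- by apply: ref_weaken (cont isT) => // z; rewrite inE => /orP[/eqP ->|].
- exact: clash_bot h.
Qed.

(** If two values are claimed for one tree, the claimed values of one of its two subtrees differ as
    well; descend there until a leaf is reached. *)
Lemma ex_unique t a b G d : a != b -> a < 2 ^ e -> b < 2 ^ e ->
  (ex t a, true) \in G -> (ex t b, true) \in G ->
  height t * (2 * e + 8) <= d -> ref s d G.
Proof.
elim: t a b G d => [f|l IHl r IHr] a b G d ab ae be ha hb hd.
  wlog lt : a b ab ae be ha hb / a < b.
    by move=> H; case: (ltngtP a b) ab => // lt _;
      [apply: (H a b)|apply: (H b a)] => //; rewrite neq_ltn lt ?orbT.
  case: b lt ab be hb => // -[|b] lt ab be hb; last exact: clash_bot hb.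
  by case: a lt ha {ab ae} => //= _ ha; apply: (@clash_neg _ _ _ _ f true).
pose d' := maxn (height l) (height r) * (2 * e + 8).
apply: (@ref_le _ _ ((d' + e + 4) + e + 4)).
  by move: hd; rewrite /= -/d' mulSn -/d'; lia.
apply: (ex_node ae ha) => i j ij; apply: (@ex_node _ l r b) => //.
  by rewrite !inE hb !orbT.
move=> i' j' ij'; case: (altP (i =P i')) => ii'.
  apply: (IHr j j'); rewrite ?inE ?eqxx ?orbT //; try lia.
  by rewrite leq_mul2r leq_maxr orbT.
apply: (IHl i i'); rewrite ?inE ?eqxx ?orbT //; try lia.
by rewrite leq_mul2r leq_maxl orbT.
Qed.

Lemma value_absurd t G d : sound t -> (some_value t, false) \in G ->
  (height t).+1 * (4 * e + 12) <= d -> ref s d G.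
Proof.
elim: t G d => [f|l IHl r IHr] G d st h hd.
  have le := sound_leaves st.
  apply: (@ref_le _ _ ((0 + e + 2) + e + 2)); first by move: hd => /=; lia.
  apply: (or_false _ h (f := Neg f)); rewrite ?size_map ?size_iota ?mem_head //.
  apply: (@or_false _ _ _ _ [:: Neg f; f] f).
  - exact: le.
  - by rewrite inE h orbT.
  - by rewrite !inE eqxx orbT.
  by apply: (@clash_neg _ _ _ _ f false); rewrite !inE eqxx ?orbT.
case: (st) => lf sz [sl sr]; rewrite [leaves _]/= in lf.
set L := [seq ex (Nd l r) j | j <- iota 0 (leaves (Nd l r)).+1] in h sz.
pose d' := (maxn (height l) (height r)).+1 * (4 * e + 12).
have dl : (height l).+1 * (4 * e + 12) <= d' by rewrite leq_mul2r ltnS leq_maxl orbT.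
have dr : (height r).+1 * (4 * e + 12) <= d' by rewrite leq_mul2r ltnS leq_maxr orbT.
apply: (@ref_le _ _ ((d' + (2 * e + 4) + e + 2).+1 + e + 2).+1).
  by move: hd; rewrite [height _]/= mulSn -/d'; lia.
apply: (@ask _ _ (some_value l)) => //; first exact: sound_size; last first.
  by apply: (IHl _ _ sl (mem_head _ _)); lia.
apply: (or_query _ (mem_head _ _)).
  by rewrite size_map size_iota; apply: sound_leaves.
move=> _ /mapP[i il ->].
apply: (@ask _ _ (some_value r)) => //; first exact: sound_size; last first.
  by apply: (IHr _ _ sr (mem_head _ _)); lia.
apply: (or_query _ (mem_head _ _)).
  by rewrite size_map size_iota; apply: sound_leaves.
move=> _ /mapP[j jl ->]; rewrite !mem_iota /= !add0n !ltnS in il jl.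
have inL : ex (Nd l r) (i + j) \in L.
  by apply: map_f; rewrite mem_iota /=; lia.
have szs : form_size (ex (Nd l r) (i + j)) <= s.
  by apply: leq_trans sz; apply: size_big_or_mem.
apply: (@ref_le _ _ (0 + e + 2 + e + 2)); first lia.
apply: (@or_false _ _ _ _ L (ex (Nd l r) (i + j))) => //.
- by rewrite size_map size_iota.
- by rewrite !inE h !orbT.
apply: (or_false _ (mem_head _ _) (f := And (ex l i) (ex r j))).
- by rewrite size_map size_iota; lia.
- apply/mapP; exists i; last by rewrite addKn.
  by rewrite mem_iota; lia.
by apply: (@clash_and _ _ _ _ (ex l i) (ex r j)); rewrite !inE eqxx ?orbT.
Qed.

Lemma value_query t G d : sound t ->
  (forall j, j <= leaves t -> ref s d ((ex t j, true) :: G)) ->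
  ref s (d + (height t).+1 * (4 * e + 12) + e + 3) G.
Proof.
move=> st cont; apply: (@ref_le _ _ (d + (height t).+1 * (4 * e + 12) + e + 2).+1); first lia.
apply: (@ask _ _ (some_value t)); first exact: sound_size.
  apply: (or_query _ (mem_head _ _)); first by rewrite size_map size_iota; apply: sound_leaves.
  move=> f /mapP[j]; rewrite mem_iota ltnS => jl ->.
  apply: ref_weaken (cont j jl); first by rewrite leq_addr.
  by move=> z; rewrite !inE => /orP[->|->]; rewrite ?orbT.
by apply: (value_absurd st (mem_head _ _)); lia.
Qed.

(* If a linear inequality between the values of three sums fails, then the
   adversary can be led to an index at which it fails for the summands. *)
Lemma mk_search h (g1 g2 g3 : nat -> tree V) (oP oN : nat -> nat)
    (l1 l2 l3 r1 r2 r3 : nat) c1 c2 c3 G d :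
  c1 < 2 ^ e -> c2 < 2 ^ e -> c3 < 2 ^ e ->
  (ex (mk h g1) c1, true) \in G -> (ex (mk h g2) c2, true) \in G ->
  (ex (mk h g3) c3, true) \in G ->
  r1 * c1 + r2 * c2 + r3 * c3 + \sum_(0 <= i < 2 ^ h) oN i <
  l1 * c1 + l2 * c2 + l3 * c3 + \sum_(0 <= i < 2 ^ h) oP i ->
  (forall i a1 a2 a3, i < 2 ^ h -> a1 < 2 ^ e -> a2 < 2 ^ e -> a3 < 2 ^ e ->
    r1 * a1 + r2 * a2 + r3 * a3 + oN i < l1 * a1 + l2 * a2 + l3 * a3 + oP i ->
    ref s d ((ex (g1 i) a1, true) :: (ex (g2 i) a2, true) :: (ex (g3 i) a3, true) :: G)) ->
  ref s (d + h * (3 * e + 12)) G.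
Proof.
elim: h g1 g2 g3 oP oN c1 c2 c3 G => [|h IH] g1 g2 g3 oP oN c1 c2 c3 G b1 b2 b3 h1 h2 h3.
  rewrite expn0 !big_nat1 => lt cont; rewrite addn0.
  apply: ref_weaken (cont 0 c1 c2 c3 _ b1 b2 b3 lt) => //.
  by move=> z; rewrite !inE => /or4P[/eqP ->|/eqP ->|/eqP ->|].
rewrite expnS mul2n -addnn => lt cont.
have split o : \sum_(0 <= i < 2 ^ h + 2 ^ h) o i
    = \sum_(0 <= i < 2 ^ h) o i + \sum_(0 <= i < 2 ^ h) o (2 ^ h + i) :> nat.
  rewrite (@big_cat_nat _ _ _ (2 ^ h)) ?leq_addr //=; congr (_ + _).
  rewrite -{1}[2 ^ h]add0n big_addn addnK; apply: eq_bigr => i _; by rewrite addnC.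
rewrite !split in lt.
apply: (@ref_le _ _ (d + h * (3 * e + 12) + e + 4 + e + 4 + e + 4)); first by rewrite mulSn; lia.
apply: (ex_node b1 h1) => i1 j1 e1.
apply: (@ex_node _ (mk h g2) (mk h (fun i => g2 (2 ^ h + i))) _ _ b2).
  by rewrite !inE h2 !orbT.
move=> i2 j2 e2.
apply: (@ex_node _ (mk h g3) (mk h (fun i => g3 (2 ^ h + i))) _ _ b3).
  by rewrite !inE h3 !orbT.
move=> i3 j3 e3; set G' := _ :: _.
have sub : {subset G <= G'} by move=> z zG; rewrite !inE zG !orbT.
have ext i a1 a2 a3 : ref s d ((ex (g1 i) a1, true) :: (ex (g2 i) a2, true)
    :: (ex (g3 i) a3, true) :: G) -> ref s d ((ex (g1 i) a1, true) :: (ex (g2 i) a2, true)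
    :: (ex (g3 i) a3, true) :: G').
  apply: ref_weaken => // z; rewrite !inE => /or4P[->|->|->|/sub]; rewrite ?orbT //.
  by rewrite /G' !inE => ->; rewrite !orbT.
set SN1 := \sum_(0 <= i < _) oN i in lt; set SP1 := \sum_(0 <= i < _) oP i in lt.
set SN2 := \sum_(0 <= i < _) oN _ in lt; set SP2 := \sum_(0 <= i < _) oP _ in lt.
have [lt1|lt2] : r1 * i1 + r2 * i2 + r3 * i3 + SN1 < l1 * i1 + l2 * i2 + l3 * i3 + SP1 \/
    r1 * j1 + r2 * j2 + r3 * j3 + SN2 < l1 * j1 + l2 * j2 + l3 * j3 + SP2.
  move: lt; rewrite -e1 -e2 -e3 !mulnDr; lia.
- apply: (IH g1 g2 g3 oP oN i1 i2 i3) => //; try lia; rewrite ?inE ?eqxx ?orbT //.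
  by move=> i a1 a2 a3 ih *; apply: ext; apply: cont => //; rewrite ltn_addr.
apply: (IH (fun i => g1 (2 ^ h + i)) (fun i => g2 (2 ^ h + i)) (fun i => g3 (2 ^ h + i))
   (fun i => oP (2 ^ h + i)) (fun i => oN (2 ^ h + i)) j1 j2 j3) => //; try lia;
  rewrite ?inE ?eqxx ?orbT //.
by move=> i a1 a2 a3 ih *; apply: ext; apply: cont => //; rewrite ltn_add2l.
Qed.

Lemma sum_search h n (g1 g2 g3 : 'I_n -> tree V) (oP oN : 'I_n -> nat)
    (l1 l2 l3 r1 r2 r3 : nat) c1 c2 c3 G d : n <= 2 ^ h ->
  c1 < 2 ^ e -> c2 < 2 ^ e -> c3 < 2 ^ e ->
  (ex (sum_tree h g1) c1, true) \in G -> (ex (sum_tree h g2) c2, true) \in G ->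
  (ex (sum_tree h g3) c3, true) \in G ->
  r1 * c1 + r2 * c2 + r3 * c3 + \sum_i oN i < l1 * c1 + l2 * c2 + l3 * c3 + \sum_i oP i ->
  (forall i a1 a2 a3, a1 < 2 ^ e -> a2 < 2 ^ e -> a3 < 2 ^ e ->
    r1 * a1 + r2 * a2 + r3 * a3 + oN i < l1 * a1 + l2 * a2 + l3 * a3 + oP i ->
    ref s d ((ex (g1 i) a1, true) :: (ex (g2 i) a2, true) :: (ex (g3 i) a3, true) :: G)) ->
  ref s (d + h * (3 * e + 12)) G.
Proof.
move=> nh b1 b2 b3 h1 h2 h3 lt cont.
pose lift (o : 'I_n -> nat) i := if insub i is Some x then o x else 0.
have sumE o : \sum_(0 <= i < 2 ^ h) lift o i = \sum_i o i.
  rewrite (@big_cat_nat _ _ _ n) //= [X in _ + X]big1_seq ?addn0.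
    rewrite big_mkord; apply: eq_bigr => i _; rewrite /lift.
    by case: insubP => [x _ /val_inj -> //|]; rewrite ltn_ord.
  move=> i; rewrite mem_index_iota => /andP[_ /andP[ni _]].
  by rewrite /lift insubN // -leqNgt.
apply: (mk_search b1 b2 b3 h1 h2 h3 (oP := lift oP) (oN := lift oN)
  (l1 := l1) (l2 := l2) (l3 := l3) (r1 := r1) (r2 := r2) (r3 := r3)).
  by rewrite !sumE.
move=> i a1 a2 a3 _ c1' c2' c3' lt'; rewrite /lift in lt'.
case: insubP lt' => [x _ _ lt'|_ lt']; first exact: cont.
(* At padded positions the only consistent value is 0 and both offsets vanish, so the strict
   inequality is impossible there. *)
have botj a b G' : (ex (Lf Bot) a, b) \in G' -> b -> 0 < a -> ref s d G'.
  by case: b a => // -[|[|a]] // h' _ _; apply: clash_bot h'.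
case: a1 c1' lt' => [|a1] c1' lt'; last first.
  by apply: (botj a1.+1 true); rewrite ?inE ?eqxx ?orbT.
case: a2 c2' lt' => [|a2] c2' lt'; last first.
  by apply: (botj a2.+1 true); rewrite ?inE ?eqxx ?orbT.
case: a3 c3' lt' => [|a3] c3' lt'; last first.
  by apply: (botj a3.+1 true); rewrite ?inE ?eqxx ?orbT.
by move: lt'; rewrite !muln0.
Qed.

Lemma sum_mem (T : finType) (J : {set T}) : \sum_x (x \in J : nat) = #|J|.
Proof. by rewrite -sum1_card [RHS]big_mkcond; apply: eq_bigr => x _; case: (x \in J). Qed.

(** The sum is compared with the indicator function of [J], whose total is smaller; an index where
    the summand exceeds the indicator lies outside [J] and carries a true formula. *)
Lemma sum_true h n (f : 'I_n -> form V) (J : {set 'I_n}) c G d : n <= 2 ^ h ->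
  c < 2 ^ e -> (ex (sum_tree h (fun x => Lf (f x))) c, true) \in G -> #|J| < c ->
  (forall x, x \notin J -> ref s d ((f x, true) :: G)) ->
  ref s (d.+1 + h * (3 * e + 12)) G.
Proof.
move=> nh ce hc lt cont.
apply: (sum_search nh ce ce ce hc hc hc (oN := fun x => x \in J) (oP := fun=> 0)
  (l1 := 1) (l2 := 0) (l3 := 0) (r1 := 0) (r2 := 0) (r3 := 0)).
  by rewrite sum_mem big1 // !mul0n mul1n !addn0.
move=> x a1 a2 a3 _ _ _; case xJ: (x \in J) => /= lt'.
  apply: (ex_leaf (mem_head _ _)) => a1l; lia.
apply: (ex_leaf (mem_head _ _)) => a1l.
have -> : a1 == 1 by lia.
apply: ref_weaken (cont x _); rewrite ?xJ // => z; rewrite !inE => /orP[->|->]; rewrite ?orbT //.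
Qed.

Lemma sum_lt_absurd h n (f : 'I_n -> form V) (J : {set 'I_n}) c G : n <= 2 ^ h ->
  c < 2 ^ e -> (ex (sum_tree h (fun x => Lf (f x))) c, true) \in G -> c < #|J| ->
  (forall x, x \in J -> (f x, true) \in G) ->
  ref s (1 + h * (3 * e + 12)) G.
Proof.
move=> nh ce hc lt fJ.
apply: (sum_search nh ce ce ce hc hc hc (oP := fun x => x \in J) (oN := fun=> 0)
  (l1 := 0) (l2 := 0) (l3 := 0) (r1 := 1) (r2 := 0) (r3 := 0)).
  by rewrite sum_mem big1 // !mul0n mul1n !addn0.
move=> x a1 a2 a3 _ _ _; case xJ: (x \in J) => /= lt'; last lia.
apply: (ex_leaf (mem_head _ _)) => a1l; have -> : a1 == 1 = false by lia.
by apply: (@clash_id _ _ _ _ (f x)); rewrite !inE ?eqxx ?fJ ?orbT.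
Qed.

(** Exchange of the order of summation, by halving the range of [x]. With the column sums over the
    two halves queried as [v1] and [v2], either [v < v1 + v2], and some column disagrees with its
    own splitting, or in one half the row total still exceeds the column total. After [h] halvings a
    single row is left. The side conditions range over reindexings [f] because each half is again a
    sum of this kind. *)
Lemma mk_fubini h hm m H (C : nat -> tree V) (A : nat -> 'I_m -> tree V) u v G d :
  m <= 2 ^ hm ->
  (forall h' f, h' <= h -> sound (sum_tree hm (fun i => mk h' (fun x => A (f x) i)))) ->
  (forall h' f, h' <= h -> height (sum_tree hm (fun i => mk h' (fun x => A (f x) i))) <= H) ->
  (forall h' f i, h' <= h -> height (mk h' (fun x => A (f x) i)) <= H) ->
  (forall x a b, a < 2 ^ e -> b < 2 ^ e -> b < a ->
     ref s d ((ex (C x) a, true) :: (ex (sum_tree hm (A x)) b, true) :: G)) ->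
  u < 2 ^ e -> v < 2 ^ e -> v < u ->
  (ex (mk h C) u, true) \in G ->
  (ex (sum_tree hm (fun i => mk h (fun x => A x i))) v, true) \in G ->
  ref s (d + h * ((3 * H + hm + 10) * (4 * e + 12))) G.
Proof.
move=> mh; set K := _ * (4 * e + 12).
elim: h C A u v G => [|h IH] C A u v G snd ht1 ht2 base ue ve vu hu hv.
  rewrite addn0; apply: ref_weaken (base 0 u v ue ve vu) => // z.
  by rewrite !inE => /or3P[/eqP ->|/eqP ->|].
pose A' x := A (2 ^ h + x).
pose T1 := sum_tree hm (fun i => mk h (fun x => A x i)).
pose T2 := sum_tree hm (fun i => mk h (fun x => A' x i)).
have s1 : sound T1 := snd h id (leqnSn h).
have s2 : sound T2 := snd h (addn (2 ^ h)) (leqnSn h).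
have t1 : height T1 <= H := ht1 h id (leqnSn h).
have t2 : height T2 <= H := ht1 h (addn (2 ^ h)) (leqnSn h).
pose Q t := (height t).+1 * (4 * e + 12).
have Q1 : Q T1 <= H.+1 * (4 * e + 12) by rewrite leq_mul2r ltnS t1 orbT.
have Q2 : Q T2 <= H.+1 * (4 * e + 12) by rewrite leq_mul2r ltnS t2 orbT.
pose D := maxn (d + h * K) (hm * (3 * e + 12) + (e + 4) + H * (2 * e + 8)).
apply: (@ref_le _ _ (D + Q T2 + e + 3 + Q T1 + e + 3 + e + 4)).
  have KE : K = 2 * (H.+1 * (4 * e + 12)) + hm * (4 * e + 12)
      + H * (4 * e + 12) + 8 * (4 * e + 12).
    by rewrite /K; lia.
  have : H * (2 * e + 8) <= H * (4 * e + 12) by rewrite leq_mul2l; lia.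
  have : hm * (3 * e + 12) <= hm * (4 * e + 12) by rewrite leq_mul2l; lia.
  rewrite mulSn /D; lia.
apply: (ex_node ue hu) => u1 u2 uE.
apply: (value_query s1) => v1 v1l; apply: (value_query s2) => v2 v2l.
have {v1l}v1e := leq_ltn_trans v1l (sound_leaves s1).
have {v2l}v2e := leq_ltn_trans v2l (sound_leaves s2).
set G' := _ :: _.
have sub : {subset G <= G'} by move=> z zG; rewrite !inE zG !orbT.
have in1 : (ex T1 v1, true) \in G' by rewrite !inE eqxx ?orbT.
have in2 : (ex T2 v2, true) \in G' by rewrite !inE eqxx ?orbT.
have ext x a b G1 G2 (C0 : tree V) : {subset G1 <= G2} ->
    ref s d ((ex C0 a, true) :: (ex (sum_tree hm (A x)) b, true) :: G1) ->
    ref s d ((ex C0 a, true) :: (ex (sum_tree hm (A x)) b, true) :: G2).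
  move=> sub'; apply: ref_weaken => // z; rewrite !inE => /or3P[->|->|/sub' ->]; rewrite ?orbT //.
case: (ltnP v (v1 + v2)) => lt.
  apply: (@ref_le _ _ ((H * (2 * e + 8) + e + 4) + hm * (3 * e + 12))); first by rewrite /D; lia.
  apply: (sum_search mh ve v1e v2e (sub _ hv) in1 in2 (oP := fun=> 0) (oN := fun=> 0)
    (l1 := 0) (l2 := 1) (l3 := 1) (r1 := 1) (r2 := 0) (r3 := 0)); first by lia.
  move=> i a1 a2 a3 a1e a2e a3e lt'.
  apply: (ex_node a1e (mem_head _ _)) => b1 b2 bE.
  have [l1|l2] : b1 < a2 \/ b2 < a3 by lia.
    apply: (@ex_unique (mk h (fun x => A x i)) b1 a2); rewrite ?inE ?eqxx ?orbT //; try lia.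
    by rewrite leq_mul2r (ht2 h id) ?orbT.
  apply: (@ex_unique (mk h (fun x => A' x i)) b2 a3); rewrite ?inE ?eqxx ?orbT //; try lia.
  by rewrite leq_mul2r (ht2 h (addn (2 ^ h))) ?orbT.
apply: (@ref_le _ _ (d + h * K)); first by rewrite /D leq_maxl.
have [l1|l2] : v1 < u1 \/ v2 < u2 by lia.
  apply: (IH C A u1 v1) => //; try lia; rewrite ?inE ?eqxx ?orbT //.
  - by move=> h' f h'h; apply: snd; apply: leqW.
  - by move=> h' f h'h; apply: ht1; apply: leqW.
  - by move=> h' f i h'h; apply: ht2; apply: leqW.
  by move=> x a b ae be ab; apply: ext sub _; apply: base.
apply: (IH (fun x => C (2 ^ h + x)) A' u2 v2) => //; try lia; rewrite ?inE ?eqxx ?orbT //.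
- by move=> h' f h'h; apply: (snd h' (fun x => 2 ^ h + f x)); apply: leqW.
- by move=> h' f h'h; apply: (ht1 h' (fun x => 2 ^ h + f x)); apply: leqW.
- by move=> h' f i h'h; apply: (ht2 h' (fun x => 2 ^ h + f x)); apply: leqW.
by move=> x a b ae be ab; apply: ext sub _; apply: base.
Qed.

End Counting.

(* [mem_conv] works up to unfolding of the formulas, which may diverge. *)
Ltac mem_fast := solve [ match goal with H : is_true (_ \in _) |- _ => exact: H end
  | by rewrite mem_head
  | rewrite in_cons; apply/orP; right; mem_fast
  | match goal with H : {subset _ <= ?G} |- is_true (_ \in ?G) => apply: H; mem_fast end ].

Ltac mem_conv := solve [ match goal with H : is_true (_ \in _) |- _ => exact: H end
  | apply: mem_head
  | rewrite in_cons; apply/orP; right; mem_conv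
  | match goal with H : {subset _ <= ?G} |- is_true (_ \in ?G) => apply: H; mem_conv end ].

Ltac mem := first [ mem_fast | mem_conv ].

Arguments big_or {V} s : simpl never.
Arguments big_and {V} s : simpl never.

(** * Size bounds *)

Section Sizes.

Variables (V : eqType) (e : nat).
Implicit Types (f g : form V) (l : seq (form V)).

(** Sizes are measured by rank: a disjunction of at most [2 ^ e] formulas, a conjunction or a
    negation enlarges the size by a factor of at most [2 ^ (e + 2)], which is one rank. *)
Definition bd r f := form_size f <= 2 ^ ((e + 2) * r).

Lemma bd_le r r' f : r <= r' -> bd r f -> bd r' f.
Proof. by move=> rr fr; apply: leq_trans fr _; rewrite leq_pexp2l // leq_mul2l rr orbT. Qed.

Lemma bd_step r : 4 * 2 ^ e * 2 ^ ((e + 2) * r) = 2 ^ ((e + 2) * r.+1).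
Proof. by rewrite mulnS !expnD; lia. Qed.

Lemma bd_const r f : form_size f = 1 -> bd r f.
Proof. by rewrite /bd => ->; rewrite expn_gt0. Qed.

Lemma bd_neg r f : bd r f -> bd r.+1 (Neg f).
Proof.
rewrite /bd -bd_step /= => fr; have := expn_gt0 2 e; have := expn_gt0 2 ((e + 2) * r); nia.
Qed.

Lemma bd_and r f g : bd r f -> bd r g -> bd r.+1 (And f g).
Proof.
rewrite /bd -bd_step /= => fr; have := expn_gt0 2 e; have := expn_gt0 2 ((e + 2) * r); nia.
Qed.

Lemma size_big_or l b : {in l, forall f, form_size f <= b} ->
  form_size (big_or l) <= size l * b.+1 + 1.
Proof.
elim: l => // f l IH lb; have fb : form_size f <= b by apply: lb; rewrite mem_head.
have {}IH : form_size (big_or l) <= size l * b.+1 + 1.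
  by apply: IH => g gl; apply: lb; rewrite inE gl orbT.
rewrite [size (f :: _)]/= mulSn; move: (size l * _) IH => z.
by case: l {lb} => [|g l] IH; rewrite big_or_cons ?size_or; lia.
Qed.

Lemma bd_or r l : size l <= 2 ^ e -> {in l, forall f, bd r f} -> bd r.+1 (big_or l).
Proof.
move=> le lb; rewrite /bd -bd_step; apply: leq_trans (size_big_or lb) _.
set q := 2 ^ e in le *; set z := 2 ^ _; have z0 : 0 < z by rewrite expn_gt0.
have q0 : 0 < q by rewrite expn_gt0.
apply: (@leq_trans (q * z.+1 + 1)); first by rewrite leq_add2r leq_mul2r le orbT.
nia.
Qed.

Lemma bd_first r l j : size l <= 2 ^ e -> {in l, forall f, bd r f} -> bd r.+3 (first l j).
Proof.
move=> le lb; apply: bd_and.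
  case: (ltnP j (size l)) => jl; last by rewrite nth_default //; apply: bd_const.
  by apply: (@bd_le r); [lia|apply: lb; apply: mem_nth].
apply: bd_neg; apply: bd_or; first by apply: leq_trans le; rewrite size_take_min geq_minr.
by move=> f /mem_take; apply: lb.
Qed.

Fixpoint leaf_bd r (t : tree V) : Prop :=
  match t with Lf f => bd r f | Nd t1 t2 => leaf_bd r t1 /\ leaf_bd r t2 end.

Lemma ex_Nd (t1 t2 : tree V) j :
  ex (Nd t1 t2) j = big_or [seq And (ex t1 i) (ex t2 (j - i)) | i <- iota 0 j.+1].
Proof. by []. Qed.

Lemma bd_ex r t j : leaf_bd r t -> j < 2 ^ e -> bd (r + 1 + 2 * height t) (ex t j).
Proof.
elim: t j => [f|t1 IH1 t2 IH2] j.
  move=> /= fr _; rewrite addn0; case: j => [|[|j]].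
  - by rewrite addn1; apply: bd_neg.
  - by apply: bd_le fr; lia.
  - exact: bd_const.
case=> b1 b2 je; rewrite ex_Nd [height _]/=; set H := maxn _ _.
have -> : r + 1 + 2 * H.+1 = (r + 1 + 2 * H).+2 by lia.
apply: bd_or; first by rewrite size_map size_iota.
move=> f /mapP[i]; rewrite mem_iota add0n => /andP[_ ij] ->; apply: bd_and.
  by apply: bd_le (IH1 i b1 _); rewrite /H; lia.
by apply: bd_le (IH2 (j - i) b2 _); rewrite /H; lia.
Qed.

Lemma sound_tree s r t H : leaf_bd r t -> leaves t < 2 ^ e -> height t <= H ->
  2 ^ ((e + 2) * (r + 2 + 2 * H)) <= s -> sound s e t.
Proof.
elim: t H => [f|t1 IH1 t2 IH2] H lt le ht rs; (split; [exact: le|apply: leq_trans rs|]) => //.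
- apply: (@bd_le (r + 1 + 2 * height (Lf f)).+1); first by rewrite /=; lia.
  apply: bd_or; first by rewrite size_map size_iota.
  by move=> g /mapP[j]; rewrite mem_iota => /andP[_ jl] ->; apply: bd_ex => //; lia.
- apply: (@bd_le (r + 1 + 2 * height (Nd t1 t2)).+1); first by move: ht; lia.
  apply: bd_or; first by rewrite size_map size_iota.
  by move=> g /mapP[j]; rewrite mem_iota => /andP[_ jl] ->; apply: bd_ex => //; lia.
have [b1 b2] := lt; split; [apply: (IH1 H)|apply: (IH2 H)] => //;
  by move: le ht => /=; lia.
Qed.

Lemma leaf_bd_mk r h (g : nat -> tree V) : (forall i, leaf_bd r (g i)) -> leaf_bd r (mk h g).
Proof. by elim: h g => //= h IH g gr; split; apply: IH. Qed.

Lemma height_mk h (g : nat -> tree V) H : (forall i, height (g i) <= H) -> height (mk h g) <= h + H.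
Proof. by elim: h g => //= h IH g gH; rewrite addSn ltnS geq_max !IH. Qed.

Lemma leaves_mk h (g : nat -> tree V) N : (forall i, leaves (g i) <= N) ->
  leaves (mk h g) <= 2 ^ h * N.
Proof.
by elim: h g => [|h IH] g gN /=; rewrite ?mul1n // expnS mul2n -addnn mulnDl leq_add // IH.
Qed.

Lemma leaf_bd_sum r h n (g : 'I_n -> tree V) : (forall i, leaf_bd r (g i)) ->
  leaf_bd r (sum_tree h g).
Proof. by move=> gr; apply: leaf_bd_mk => i; case: insub => //; apply: bd_const. Qed.

Lemma height_sum h n (g : 'I_n -> tree V) H : (forall i, height (g i) <= H) ->
  height (sum_tree h g) <= h + H.
Proof. by move=> gH; apply: height_mk => i; case: insub. Qed.

Lemma leaves_sum h n (g : 'I_n -> tree V) N : 0 < N -> (forall i, leaves (g i) <= N) ->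
  leaves (sum_tree h g) <= 2 ^ h * N.
Proof. by move=> N0 gN; apply: leaves_mk => i; case: insub. Qed.

End Sizes.

(** * The strategy for Kneser's formulas *)

Section Strategy.

Variables n m k h e : nat.
Local Notation V := ({set 'I_n} * 'I_m)%type.
Local Notation u := (4 * e + 12).

(* Locked, since unification may otherwise unfold the enumeration. *)
Definition ksets : seq {set 'I_n} := locked (enum [set A : {set 'I_n} | #|A| == k]).

Hypothesis k0 : 0 < k.
Hypothesis nh : n <= 2 ^ h.
Hypothesis mh : m <= 2 ^ h.
Hypothesis he : 2 * h < e.
Hypothesis ksets_le : size ksets * n * size ksets + size ksets <= 2 ^ e.

(** Large enough for double sums: their leaves have rank at most 8, and a tree of height [2 * h]
    adds two ranks per level, one for the conjunctions and one for the disjunction. *)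
Let s := 2 ^ ((e + 2) * (11 + 4 * h)).

Implicit Types (G : seq (lit V)) (i : 'I_m) (x : 'I_n) (Z S : {set 'I_n}).

(** * Stars, centres and witness sets as formulas *)

Definition has_colour S i : form V := Var (S, i).
Definition members i : seq (form V) := [seq has_colour A i | A <- ksets].
Definition avoid x : seq {set 'I_n} := [seq B : {set 'I_n} <- ksets | x \notin B].
Definition members_avoiding i x : seq (form V) := [seq has_colour B i | B <- avoid x].
(* [x] is not common to all the sets of colour [i]; hence [centre i x] says that [x]
   is the first common element of these sets. *)
Definition bad i x := big_or (members_avoiding i x).
Definition goods i := [seq Neg (bad i x) | x <- enum 'I_n].
Definition centre i x := first (goods i) x.
(** A colour that occurs on no set counts as a star centred at the first vertex, since every vertex
    is vacuously common to its sets. Hence each colour is either not a star or has exactly one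
    centre. *)
Definition kept x := Neg (big_or [seq centre i x | i <- enum 'I_m]).
Definition nonstar i := Neg (big_or [seq centre i x | x <- enum 'I_n]).

(* [witness i x]: either [x] lies in the first set [A] of colour [i], or there is an
   [a] in [A] such that [x] lies in the first set of colour [i] that avoids [a]. *)
Definition witness_list i x :=
  [seq first (members i) j | j <- iota 0 (size ksets) & x \in nth set0 ksets j] ++
  [seq And (first (members i) t.1.1) (first (members_avoiding i t.1.2) t.2) |
    t <- [seq (p, j) | p <- [seq (j, a) | j <- iota 0 (size ksets), a <- enum 'I_n],
                       j <- iota 0 (size ksets)] &
    [&& t.1.2 \in nth set0 ksets t.1.1, t.2 < size (avoid t.1.2) &
        x \in nth set0 (avoid t.1.2) t.2]].
Definition witness i x := big_or (witness_list i x).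
Definition incident i x := And (nonstar i) (witness i x).

Lemma ksets_card S : (S \in ksets) = (#|S| == k).
Proof. by rewrite /ksets -lock mem_enum inE. Qed.

Lemma size_ksets : size ksets <= 2 ^ e.
Proof. by apply: leq_trans ksets_le; apply: leq_addl. Qed.

Lemma h_lt_e : 2 ^ h <= 2 ^ e.
Proof. by rewrite leq_pexp2l //; lia. Qed.

Lemma size_members i : size (members i) <= 2 ^ e.
Proof. by rewrite size_map size_ksets. Qed.

Lemma size_members_avoiding i x : size (members_avoiding i x) <= 2 ^ e.
Proof. by rewrite size_map size_filter (leq_trans (count_size _ _)) ?size_ksets. Qed.

Lemma size_goods i : size (goods i) = n.
Proof. by rewrite size_map size_enum_ord. Qed.

Lemma n_le : n <= 2 ^ e. Proof. exact: leq_trans nh h_lt_e. Qed.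
Lemma m_le : m <= 2 ^ e. Proof. exact: leq_trans mh h_lt_e. Qed.

Lemma size_witness_list i x : size (witness_list i x) <= 2 ^ e.
Proof.
rewrite size_cat 2!size_map addnC; apply: leq_trans ksets_le; apply: leq_add.
  rewrite size_filter (leq_trans (count_size _ _)) //.
  by rewrite !size_allpairs !size_iota size_enum_ord.
by rewrite size_filter (leq_trans (count_size _ _)) ?size_iota.
Qed.

Lemma bd_size r (f : form V) : bd e r f -> r <= 11 + 4 * h -> form_size f <= s.
Proof. by move=> fr rr; apply: leq_trans fr _; rewrite leq_pexp2l // leq_mul2l rr orbT. Qed.

Lemma bd_members i : {in members i, forall f, bd e 0 f}.
Proof. by move=> f /mapP[A _ ->]; apply: bd_const. Qed.

Lemma bd_members_avoiding i x : {in members_avoiding i x, forall f, bd e 0 f}.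
Proof. by move=> f /mapP[A _ ->]; apply: bd_const. Qed.

Lemma bd_bad i x : bd e 1 (bad i x).
Proof. by apply: bd_or; [apply: size_members_avoiding|apply: bd_members_avoiding]. Qed.

Lemma bd_goods i : {in goods i, forall f, bd e 2 f}.
Proof. by move=> f /mapP[x _ ->]; apply: bd_neg; apply: bd_bad. Qed.

Lemma bd_centre i x : bd e 5 (centre i x).
Proof. by apply: bd_first; [rewrite size_goods n_le|apply: bd_goods]. Qed.

Lemma bd_kept x : bd e 7 (kept x).
Proof.
apply: bd_neg; apply: bd_or; first by rewrite size_map size_enum_ord m_le.
by move=> f /mapP[i _ ->]; apply: bd_centre.
Qed.

Lemma bd_nonstar i : bd e 7 (nonstar i).
Proof.
apply: bd_neg; apply: bd_or; first by rewrite size_map size_enum_ord n_le.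
by move=> f /mapP[x _ ->]; apply: bd_centre.
Qed.

Lemma bd_first_member i j : bd e 3 (first (members i) j).
Proof. by apply: bd_first; [apply: size_members|apply: bd_members]. Qed.

Lemma bd_first_avoiding i x j : bd e 3 (first (members_avoiding i x) j).
Proof. by apply: bd_first; [apply: size_members_avoiding|apply: bd_members_avoiding]. Qed.

Lemma bd_witness i x : bd e 5 (witness i x).
Proof.
apply: bd_or; first exact: size_witness_list.
move=> f; rewrite mem_cat => /orP[] /mapP[t _ ->].
  by apply: bd_le (bd_first_member _ _).
by apply: bd_and; [apply: bd_first_member|apply: bd_first_avoiding].
Qed.

Lemma bd_incident i x : bd e 8 (incident i x).
Proof. by apply: bd_and; [apply: bd_nonstar|apply: bd_le (bd_witness i x)]. Qed.

Lemma nth_goods i x : nth Bot (goods i) x = Neg (bad i x).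
Proof. by rewrite (nth_map x) ?size_enum_ord // nth_ord_enum. Qed.

Lemma nth_members i j : j < size ksets -> nth Bot (members i) j = has_colour (nth set0 ksets j) i.
Proof. by move=> jl; rewrite (nth_map set0). Qed.

Lemma nth_members_avoiding i x j : j < size (avoid x) ->
  nth Bot (members_avoiding i x) j = has_colour (nth set0 (avoid x) j) i.
Proof. by move=> jl; rewrite (nth_map set0). Qed.

(** A centre [x] of colour [i] cannot lie in [S], whose elements are kept; but then [S] avoids [x]
    and has colour [i], so [x] is not common to all sets of that colour. *)
Lemma colour_nonstar d G S i : #|S| = k -> (has_colour S i, true) \in G ->
  (forall x, x \in S -> (kept x, true) \in G) ->
  ref s d ((nonstar i, true) :: G) -> ref s (d + u) G.
Proof.
move=> Sk hS Sx cont; apply: (@ref_le _ _ (d + (2 * e + 9)).+1); first lia.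
apply: (@ask _ _ (nonstar i)); first by apply: bd_size (bd_nonstar i) _.
  by apply: ref_le cont; lia.
apply: (@ref_le _ _ ((e + 1).+3 + e + 2).+1); first lia.
apply: (@neg_query _ _ _ _ (big_or [seq centre i x | x <- enum 'I_n]) false); first mem.
apply: (or_query _ (mem_head _ _)); first by rewrite size_map size_enum_ord n_le.
move=> f /mapP[x _ ->]; apply: (first_nth (mem_head _ _)); rewrite nth_goods.
apply: (@neg_query _ _ _ _ (bad i x) true); first mem.
case xS: (x \in S).
  apply: (@neg_query _ _ _ _ (big_or [seq centre i x | i <- enum 'I_m]) true).
    by have := Sx _ xS => ?; mem.
  apply: (@or_intro _ _ _ e [seq centre i x | i <- enum 'I_m] (centre i x)) => //.
  - by rewrite size_map size_enum_ord m_le.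
  - by mem.
  - by apply: map_f; rewrite mem_enum.
  - by mem.
  by rewrite addn1.
apply: (@or_intro _ _ _ e (members_avoiding i x) (has_colour S i)).
- exact: size_members_avoiding.
- by mem.
- by apply: map_f; rewrite mem_filter xS ksets_card Sk /=.
- by mem.
lia.
Qed.

(** If some vertex were common to all sets of colour [i], the first such vertex would be a
    centre. *)
Lemma bad_of_nonstar d G i x : (nonstar i, true) \in G ->
  ref s d ((bad i x, true) :: G) -> ref s (d + 2 * u) G.
Proof.
move=> hi cont; apply: (@ref_le _ _ (d + (8 * e + 23)).+1); first lia.
apply: (@ask _ _ (bad i x)); first by apply: bd_size (bd_bad i x) _.
  by apply: ref_le cont; lia.
apply: (@ref_le _ _ ((e + 1).+1 + 3 * e + 9).+1); first lia.
apply: (@ask _ _ (big_or (goods i))).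
- by apply: (@bd_size 3) => //; apply: bd_or; [rewrite size_goods n_le|apply: bd_goods].
- apply: (@min_query _ _ _ e (goods i)); [by rewrite size_goods n_le|mem| |].
    move=> j _; apply: (@bd_size 5) => //.
    by apply: bd_first; [rewrite size_goods n_le|apply: bd_goods].
  move=> j; rewrite size_goods => jn.
  apply: (@neg_query _ _ _ _ (big_or [seq centre i x | x <- enum 'I_n]) true); first mem.
  apply: (@or_intro _ _ _ e [seq centre i x | x <- enum 'I_n] (centre i (Ordinal jn))).
  - by rewrite size_map size_enum_ord n_le.
  - mem.
  - by apply: map_f; rewrite mem_enum.
  - by rewrite /centre /=; mem.
  by rewrite addn1.
apply: (@ref_le _ _ (0 + e + 2)); first lia.
apply: (@or_false _ _ _ e (goods i) (Neg (bad i x))).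
- by rewrite size_goods n_le.
- mem.
- by apply: map_f; rewrite mem_enum.
by apply: (@clash_neg _ _ _ _ (bad i x) false); mem.
Qed.

Lemma avoid_card x j : j < size (avoid x) -> #|nth set0 (avoid x) j| = k.
Proof.
move=> jl; have := mem_nth set0 jl; rewrite mem_filter ksets_card => /andP[_].
by move/eqP.
Qed.

Lemma avoid_notin x j : j < size (avoid x) -> x \notin nth set0 (avoid x) j.
Proof. by move=> jl; have := mem_nth set0 jl; rewrite mem_filter => /andP[]. Qed.

Lemma ksets_nth j : j < size ksets -> #|nth set0 ksets j| = k.
Proof. by move=> jl; have := mem_nth set0 jl; rewrite ksets_card => /eqP. Qed.

Lemma avoiding_explicit i (xs : seq 'I_n) Z G d :
  (forall Z' G', {subset G <= G'} -> Z \subset Z' -> #|Z'| <= #|Z| + size xs * k ->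
    (forall a, a \in xs -> forall j, j < size (avoid a) ->
       ~~ (nth set0 (avoid a) j \subset Z') ->
       ref s (e + 6) ((first (members_avoiding i a) j, true) :: G')) ->
    ref s d G') ->
  ref s (d + size xs * u) G.
Proof.
elim: xs Z G => [|a xs IH] Z G cont.
  by rewrite addn0; apply: (cont Z) => //; rewrite addn0.
apply: (@ref_le _ _ (d + size xs * u + 3 * e + 9).+1).
  by rewrite -[size (a :: xs)]/(size xs).+1 mulSn; lia.
have szb := bd_size (bd_bad i a) (isT : 1 <= 11 + 4 * h).
have szm := size_members_avoiding i a.
apply: (@ask _ _ (bad i a)) => //.
  apply: (@min_query _ _ _ e (members_avoiding i a)) => //; first mem.
    by move=> j _; apply: (@bd_size 3) => //; apply: bd_first_avoiding.
  rewrite size_map => j0 j0l; apply: (IH (Z :|: nth set0 (avoid a) j0)).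
  move=> Z' G' sub ZZ' cZ' H; apply: (cont Z') => //.
  - by move=> z zG; apply: sub; rewrite !inE zG !orbT.
  - by apply: subset_trans ZZ'; apply: subsetUl.
  - apply: leq_trans cZ' _; rewrite -[size (a :: xs)]/(size xs).+1 mulSn addnA leq_add2r.
    by apply: leq_trans (leq_card_setU _ _) _; rewrite avoid_card.
  move=> b; rewrite inE => /orP[/eqP ->|bxs] j jl nZ; last exact: H.
  have jj : j != j0.
    apply: contraNneq nZ => ->; apply: subset_trans ZZ'; exact: subsetUr.
  apply: (@first_unique _ _ _ e (members_avoiding i a) j j0) => //; rewrite ?size_map //.
  - mem.
  - by rewrite inE sub ?orbT // mem_head.
  lia.
apply: (@ref_le _ _ (d + size xs * u)); first lia.
apply: (IH Z) => Z' G' sub ZZ' cZ' H; apply: (cont Z') => //.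
- by move=> z zG; apply: sub; rewrite inE zG orbT.
- by apply: leq_trans cZ' _; rewrite leq_add2l leq_mul2r leqnSn orbT.
move=> b; rewrite inE => /orP[/eqP ->|bxs] j jl nZ; last exact: H.
apply: (@first_or _ _ _ e (members_avoiding i a) j) => //; rewrite ?size_map //.
- mem.
- by rewrite inE sub ?orbT // mem_head.
lia.
Qed.

(** Turns the implicit witness set of colour [i] into an actual bounded set [Z]: k elements from the
    first set of the colour, and at most k more for each of its k elements. If the colour does not
    occur, the empty set serves. *)
Lemma witness_explicit i G d :
  (forall Z G', {subset G <= G'} -> #|Z| <= k + k * k ->
    (forall x, x \notin Z -> ref s u ((witness i x, true) :: G')) -> ref s d G') ->
  ref s (d + k.+1 * u) G.
Proof.
move=> cont; have szM := size_members i.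
apply: (@ref_le _ _ (d + k * u + 3 * e + 9).+1); first by rewrite mulSn; lia.
apply: (@ask _ _ (big_or (members i))).
- by apply: (@bd_size 1) => //; apply: bd_or => //; apply: bd_members.
- apply: (@min_query _ _ _ e (members i)) => //; first mem.
    by move=> j _; apply: (@bd_size 3) => //; apply: bd_first_member.
  rewrite size_map => j0 j0l; set A := nth set0 ksets j0.
  have cA : size (enum A) = k by rewrite -cardE ksets_nth.
  rewrite -{1}cA; apply: (avoiding_explicit (i := i) (Z := A)) => Z G' sub AZ cZ H.
  apply: (cont Z).
  + by move=> z zG; apply: sub; rewrite !inE zG !orbT.
  + by apply: leq_trans cZ _; rewrite cA ksets_nth.
  move=> x xZ; apply: (@ref_le _ _ ((e + 6).+2 + e + 2)); first lia.
  apply: (or_query _ (mem_head _ _)); first exact: size_witness_list.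
  have in0 : (first (members i) j0, true) \in G' by apply: sub; rewrite mem_head.
  move=> f; rewrite mem_cat => /orP[] /mapP[t]; rewrite mem_filter => /andP[].
    move=> xt; rewrite mem_iota add0n => /andP[_ tl] ->.
    have tj : t != j0 by apply: contraNneq xZ => tj; apply: (subsetP AZ); rewrite /A -tj.
    apply: (@first_unique _ _ _ e (members i) t j0); rewrite ?size_map //; try mem; lia.
  case: t => -[j a] j' /= /and3P[aj j'l xB] /allpairsP[[[j1 a1] j2] /= [jaI _ [jE aE _]]] ->.
  case/allpairsP: jaI => -[j3 a3] /= [j3I _ [j3E _]].
  have jl : j < size ksets by move: j3I; rewrite jE j3E mem_iota.
  apply: (@and_query _ _ _ _ (first (members i) j)); first mem.
  case: (altP (j =P j0)) => [jj0|jj0]; last first.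
    apply: (@first_unique _ _ _ e (members i) j j0); rewrite ?size_map //; try mem; lia.
  apply: ref_weaken (leqnn _) _ (H a _ j' j'l _).
  + by move=> z; rewrite !inE => /orP[/eqP ->|->]; rewrite ?eqxx ?orbT.
  + by rewrite mem_enum /A -jj0.
  by apply: contraNN xZ => /subsetP; apply.
apply: (@ref_le _ _ d); first lia.
apply: (cont set0); rewrite ?cards0 //; first by move=> z zG; rewrite inE zG orbT.
move=> x _; apply: (@ref_le _ _ ((e + 6).+2 + e + 2)); first lia.
apply: (or_query _ (mem_head _ _)); first exact: size_witness_list.
move=> f; rewrite mem_cat => /orP[] /mapP[t]; rewrite mem_filter => /andP[].
  move=> xt; rewrite mem_iota add0n => /andP[_ tl] ->.
  apply: (@first_or _ _ _ e (members i) t); rewrite ?size_map //; try mem; lia.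
case: t => -[j a] j' /= _ /allpairsP[[[j1 a1] j2] /= [jaI _ [jE aE _]]] ->.
case/allpairsP: jaI => -[j3 a3] /= [j3I _ [j3E _]].
have jl : j < size ksets by move: j3I; rewrite jE j3E mem_iota.
apply: (@and_query _ _ _ _ (first (members i) j)); first mem.
apply: (@first_or _ _ _ e (members i) j); rewrite ?size_map //; try mem; lia.
Qed.

(** A common price for all counting steps. The dearest is the exchange of summation, whose trees
    have height at most [2 * h]; this is where 3(2h) + h + 10 = 7h + 10 comes from. *)
Let Q := (h + 1) * (7 * h + 11) * u.

Lemma u_le_Q : u <= Q.
Proof. by rewrite /Q leq_pmull // muln_gt0 !addn1 /= addnS. Qed.

Lemma search_le_Q : 2 + h * (3 * e + 12) <= Q.
Proof.
apply: (@leq_trans (h.+1 * u)); first by rewrite mulSn; nia.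
by rewrite leq_mul2r addn1 leq_pmulr ?orbT // addnS.
Qed.

Lemma value_le_Q (t : tree V) : height t <= 2 * h ->
  (height t).+1 * u + e + 3 <= Q.
Proof.
move=> th; apply: (@leq_trans ((2 * h + 2) * u)).
  have : (height t).+1 * u <= (2 * h + 1) * u by rewrite leq_mul2r; lia.
  by rewrite [(2 * h + 2) * u](_ : _ = (2 * h + 1) * u + u); lia.
by rewrite leq_mul2r; apply/orP; right; nia.
Qed.

Lemma fubini_le_Q : h * (2 * e + 8) + h * ((3 * (2 * h) + h + 10) * u) <= Q.
Proof.
apply: (@leq_trans (h * u + h * ((7 * h + 10) * u))).
  by rewrite leq_add // !leq_mul2l; [lia|rewrite leq_mul2r; lia].
rewrite /Q -!mulnA -mulnDr leq_mul ?leq_addr //.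
by rewrite [(7 * h + 11) * u](_ : _ = u + (7 * h + 10) * u); lia.
Qed.

Lemma sum_sound (n' : nat) (g : 'I_n' -> tree V) : (forall z, leaf_bd e 8 (g z)) ->
  (forall z, height (g z) <= h) -> (forall z, leaves (g z) <= 2 ^ h) ->
  sound s e (sum_tree h g).
Proof.
move=> gb gh gl; apply: (@sound_tree _ _ _ 8 _ (2 * h)).
- exact: leaf_bd_sum.
- apply: leq_ltn_trans (@leaves_sum _ h _ g (2 ^ h) _ gl) _; rewrite ?expn_gt0 //.
  by rewrite -expnD ltn_exp2l //; lia.
- by apply: leq_trans (@height_sum _ h _ g h gh) _; lia.
by rewrite leq_pexp2l // leq_mul2l; lia.
Qed.

Lemma sum_height (n' : nat) (g : 'I_n' -> tree V) : (forall z, height (g z) <= h) ->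
  height (sum_tree h g) <= 2 * h.
Proof. by move=> gh; apply: leq_trans (@height_sum _ h _ g h gh) _; lia. Qed.

Definition count (n' : nat) (f : 'I_n' -> form V) := sum_tree h (fun z => Lf (f z)).

Lemma count_height (n' : nat) (f : 'I_n' -> form V) : height (count f) <= h.
Proof. by apply: leq_trans (@height_sum _ _ _ _ 0 _) _; rewrite ?addn0. Qed.

Lemma count_leaves (n' : nat) (f : 'I_n' -> form V) : leaves (count f) <= 2 ^ h.
Proof. by apply: leq_trans (@leaves_sum _ _ _ _ 1 _ _) _; rewrite ?muln1. Qed.

Lemma count_bd (n' : nat) (f : 'I_n' -> form V) : (forall z, bd e 8 (f z)) ->
  leaf_bd e 8 (count f).
Proof. by move=> fb; apply: leaf_bd_sum. Qed.

Lemma fubini (n1 n2 : nat) (b : 'I_n1 -> 'I_n2 -> form V) p q G :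
  n1 <= 2 ^ h -> n2 <= 2 ^ h -> (forall z y, bd e 8 (b z y)) ->
  p < 2 ^ e -> q < 2 ^ e -> q < p ->
  (ex (sum_tree h (fun z => count (b z))) p, true) \in G ->
  (ex (sum_tree h (fun y => count (b^~ y))) q, true) \in G ->
  ref s Q G.
Proof.
move=> n1h n2h bb pe qe qp hp hq; apply: ref_le fubini_le_Q _.
pose C j := if insub j is Some z then count (b z) else Lf Bot.
pose A j y := if insub j is Some z then Lf (b z y) else Lf Bot.
have Abd j y : leaf_bd e 8 (A j y).
  by rewrite /A; case: insub => [z|] /=; [apply: bb|apply: bd_const].
have Aht h' (f : nat -> nat) y : h' <= h -> height (mk h' (fun j => A (f j) y)) <= h.
  move=> hh; apply: leq_trans (@height_mk _ h' _ 0 _) _; last by rewrite addn0.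
  by move=> j; rewrite /A; case: insub.
have Alv h' (f : nat -> nat) y : h' <= h -> leaves (mk h' (fun j => A (f j) y)) <= 2 ^ h.
  move=> hh; apply: leq_trans (@leaves_mk _ h' _ 1 _) _.
    by move=> j; rewrite /A; case: insub.
  by rewrite muln1 leq_pexp2l.
apply: (@mk_fubini _ _ _ h h n2 (2 * h) C A p q) => //.
- move=> h' f hh; apply: sum_sound => y; [|exact: Aht|exact: Alv].
  by apply: leaf_bd_mk => j; apply: Abd.
- by move=> h' f hh; apply: sum_height => y; apply: Aht.
- by move=> h' f y hh; apply: leq_trans (Aht h' f y hh) _; lia.
move=> j a c ae ce ca; rewrite /C /A; case: insub => [z|].
  apply: (@ex_unique _ _ e (count (b z)) a c) => //; [lia|mem|mem|].
  by rewrite leq_mul2r count_height orbT.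
by case: a ca ae => // -[|a] _ _; apply: clash_bot; mem.
Qed.

Lemma count_query (n' : nat) (f : 'I_n' -> form V) d G : (forall z, bd e 8 (f z)) ->
  (forall c, c < 2 ^ e -> ref s d ((ex (count f) c, true) :: G)) -> ref s (d + Q) G.
Proof.
move=> fb cont; have st : sound s e (count f).
  by apply: sum_sound => z; rewrite /= ?expn_gt0 //; apply: fb.
apply: (@ref_le _ _ (d + (height (count f)).+1 * u + e + 3)).
  by have := @value_le_Q (count f); have := count_height f; lia.
apply: (value_query st) => c cl; apply: cont; exact: leq_ltn_trans cl (sound_leaves st).
Qed.

Lemma double_query (n1 n2 : nat) (b : 'I_n1 -> 'I_n2 -> form V) d G :
  (forall z y, bd e 8 (b z y)) ->
  (forall c, c < 2 ^ e ->
     ref s d ((ex (sum_tree h (fun z => count (b z))) c, true) :: G)) -> ref s (d + Q) G.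
Proof.
move=> bb cont; set t := sum_tree h _ in cont.
have st : sound s e t.
  by apply: sum_sound => z; [apply: count_bd|apply: count_height|apply: count_leaves].
have ht : height t <= 2 * h by apply: sum_height => z; apply: count_height.
apply: (@ref_le _ _ (d + (height t).+1 * u + e + 3)).
  by have := value_le_Q ht; lia.
apply: (value_query st) => c cl; apply: cont; exact: leq_ltn_trans cl (sound_leaves st).
Qed.

Lemma count_pick (n' : nat) (f : 'I_n' -> form V) (J : {set 'I_n'}) c G d : n' <= 2 ^ h ->
  c < 2 ^ e -> (ex (count f) c, true) \in G -> #|J| < c ->
  (forall z, z \notin J -> ref s d ((f z, true) :: G)) -> ref s (d + Q) G.
Proof.
move=> nh' ce hc Jc cont.
apply: (@ref_le _ _ (d.+1 + h * (3 * e + 12))); first by have := search_le_Q; lia.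
exact: (sum_true nh' ce hc Jc).
Qed.

Lemma count_absurd (n' : nat) (f : 'I_n' -> form V) (J : {set 'I_n'}) c G : n' <= 2 ^ h ->
  c < 2 ^ e -> (ex (count f) c, true) \in G -> c < #|J| ->
  (forall z, z \in J -> (f z, true) \in G) -> ref s Q G.
Proof.
move=> nh' ce hc Jc fJ; apply: (@ref_le _ _ (1 + h * (3 * e + 12))).
  by have := search_le_Q; lia.
exact: (sum_lt_absurd nh' ce hc Jc).
Qed.

Lemma bd8_kept x : bd e 8 (kept x). Proof. exact: bd_le (bd_kept x). Qed.
Lemma bd8_nonstar i : bd e 8 (nonstar i). Proof. exact: bd_le (bd_nonstar i). Qed.
Lemma bd8_centre i x : bd e 8 (centre i x). Proof. exact: bd_le (bd_centre i x). Qed.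

(** Count the pairs of a colour and its centre twice. Every vertex that is not kept is a centre, so
    there are at least n - cX pairs; a star has one centre and other colours none, so there are at
    most m - cY. The cases [lt1] and [lt2] are the failures of these two bounds. *)
Lemma balance cX cY G : cX < 2 ^ e -> cY < 2 ^ e -> cX + m < cY + n ->
  (ex (count kept) cX, true) \in G -> (ex (count nonstar) cY, true) \in G ->
  ref s (6 * Q) G.
Proof.
have ones n' : \sum_(z < n') 1 = n' by rewrite big_const_ord iter_addn mul1n addn0.
move=> cXe cYe lt hX hY; have uQ := u_le_Q; have sQ := search_le_Q.
apply: (@ref_le _ _ (4 * Q + Q + Q)); first lia.
apply: (@double_query _ _ (fun x i => centre i x)) => [x i|p pe]; first exact: bd8_centre.
apply: (@double_query _ _ (fun i x => centre i x)) => [i x|q qe]; first exact: bd8_centre.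
case: (ltnP q p) => qp.
  apply: (@ref_le _ _ Q); first lia.
  by apply: (@fubini _ _ (fun x i => centre i x) p q) => //; [move=> *; exact: bd8_centre|mem|mem].
apply: (@ref_le _ _ (2 * Q + u + h * (3 * e + 12))); first lia.
have [lt1|lt2] : cX + p < n \/ m < q + cY by lia.
  set G' := _ :: _.
  have hX' : (ex (count kept) cX, true) \in G' by rewrite /G'; mem.
  have hp : (ex (sum_tree h (fun x => count (fun i => centre i x))) p, true) \in G'.
    by rewrite /G'; mem.
  apply: (sum_search nh cXe pe pe hX' hp hp (oP := fun=> 1) (oN := fun=> 0)
    (l1 := 0) (l2 := 0) (l3 := 0) (r1 := 1) (r2 := 1) (r3 := 0)).
    by rewrite ones big1 //; lia.
  move=> x a1 a2 a3 _ a2e _ lt'; have [a10 a20] : a1 = 0 /\ a2 = 0 by lia.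
  apply: (@ref_le _ _ ((Q.+1 + e + 2).+2)); first lia.
  apply: (@ex_leaf _ _ _ (kept x) a1); first mem.
  rewrite a10 => _.
  apply: (@neg_query _ _ _ _ (big_or [seq centre i x | i <- enum 'I_m]) false); first mem.
  apply: (or_query _ (mem_head _ _)); first by rewrite size_map size_enum_ord m_le.
  move=> f /mapP[i _ ->]; apply: (@ref_le _ _ Q) => //.
  apply: (@count_absurd _ (fun i => centre i x) [set i] a2) => //; first mem.
    by rewrite a20 cards1.
  by move=> i'; rewrite inE => /eqP ->; mem.
set G' := _ :: _.
have hY' : (ex (count nonstar) cY, true) \in G' by rewrite /G'; mem.
have hq : (ex (sum_tree h (fun i => count (fun x => centre i x))) q, true) \in G'.
  by rewrite /G'; mem.
apply: (sum_search mh cYe qe qe hY' hq hq (oP := fun=> 0) (oN := fun=> 1)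
  (l1 := 1) (l2 := 1) (l3 := 0) (r1 := 0) (r2 := 0) (r3 := 0)).
  by rewrite ones big1 //; lia.
move=> i a1 a2 a3 _ a2e _ lt'.
set OR := big_or [seq centre i x | x <- enum 'I_n].
have szl : size [seq centre i x | x <- enum 'I_n] <= 2 ^ e by rewrite size_map size_enum_ord n_le.
have inl x : centre i x \in [seq centre i x | x <- enum 'I_n] by apply: map_f; rewrite mem_enum.
have none d G1 : (OR, false) \in G1 -> (ex (count (fun x => centre i x)) a2, true) \in G1 ->
    0 < a2 -> ref s (u + Q + d) G1.
  move=> hOR ha2 a20; apply: (@ref_le _ _ (u + Q)); first lia.
  apply: (@count_pick _ (fun x => centre i x) set0 a2) => //; first by rewrite cards0.
  move=> x _; apply: (@or_intro _ _ _ e _ (centre i x) _ szl) => //; try mem; lia.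
apply: (@ref_le _ _ ((2 * Q + (4 * e + 10)).+1)); first lia.
apply: (@ex_leaf _ _ _ (nonstar i) a1); first mem.
move=> a1l; case: (altP (a1 =P 1)) => a11.
  apply: (@ref_le _ _ (u + Q + 1).+1); first lia.
  apply: (@neg_query _ _ _ _ OR true); first mem.
  by apply: none; try mem; lia.
apply: (@ref_le _ _ (Q + (4 * e + 9)).+1); first lia.
apply: (@neg_query _ _ _ _ OR false); first mem.
apply: (@ref_le _ _ (e + 5 + Q + e + 2)); first lia.
apply: (or_query szl (mem_head _ _)) => f /mapP[x _ ->].
apply: (@count_pick _ (fun x => centre i x) [set x] a2) => //; first mem.
  by rewrite cards1; lia.
move=> x'; rewrite inE => xx'.
apply: (@first_unique _ _ _ e (goods i) x x'); rewrite ?size_goods ?n_le //; try mem.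
  by rewrite eq_sym.
lia.
Qed.

(** * Greedy choice of vertices that share no witness set *)

Let K := k + k * k.

Lemma K_gt0 : 0 < K. Proof. by rewrite /K; lia. Qed.

Lemma sum_mulmem (T : finType) (J : {set T}) c : \sum_z c * (z \in J : nat) = c * #|J|.
Proof. by rewrite -big_distrr /= sum_mem. Qed.

(** Averaging: each witness set has at most [K] elements, hence there are at most [K * cY]
    incidences. If all kept vertices outside [Z] had at least [2 * K], there would be at least 2K(cX
    - #|Z|), which is more, as [cY < cX] and [2 * #|Z| <= cY]. *)
Lemma low_degree Z cX cY G d : cX < 2 ^ e -> cY < 2 ^ e -> cY < cX -> 2 * #|Z| <= cY ->
  (ex (count kept) cX, true) \in G -> (ex (count nonstar) cY, true) \in G ->
  (forall x c, x \notin Z -> c < 2 * K -> c < 2 ^ e ->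
     ref s d ((kept x, true) :: (ex (count (fun i => incident i x)) c, true) :: G)) ->
  ref s (d + (k + 7) * Q) G.
Proof.
move=> cXe cYe lt cZ hX hY cont; have uQ := u_le_Q; have sQ := search_le_Q; have K0 := K_gt0.
have bi8 i x : bd e 8 (incident i x) := bd_incident i x.
apply: (@ref_le _ _ (d + (k + 5) * Q + Q + Q)); first by lia.
apply: (@double_query _ _ (fun x i => incident i x)) => [x i|p pe]; first exact: bd_incident.
apply: (@double_query _ _ (fun i x => incident i x)) => [i x|q qe]; first exact: bd_incident.
case: (ltnP q p) => qp.
  apply: (@ref_le _ _ Q); first nia.
  by apply: (@fubini _ _ (fun x i => incident i x) p q) => //; mem.
have kQ : k.+1 * u <= k.+1 * Q by rewrite leq_mul2l uQ orbT.
have [lt1|lt2] : p + 2 * K * #|Z| < 2 * K * cX \/ K * cY < q by nia.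
  apply: (@ref_le _ _ (d.+1 + h * (3 * e + 12))); first by nia.
  set G' := _ :: _.
  have hX' : (ex (count kept) cX, true) \in G' by rewrite /G'; mem.
  have hp : (ex (sum_tree h (fun x => count (fun i => incident i x))) p, true) \in G'.
    by rewrite /G'; mem.
  apply: (sum_search nh cXe pe pe hX' hp hp (oP := fun=> 0) (oN := fun x => 2 * K * (x \in Z : nat))
    (l1 := 2 * K) (l2 := 0) (l3 := 0) (r1 := 0) (r2 := 1) (r3 := 0)).
    by rewrite sum_mulmem big1 // !mul0n mul1n !addn0 add0n.
  move=> x a1 a2 a3 _ a2e _ lt'.
  apply: (@ex_leaf _ _ _ (kept x) a1); first mem.
  move=> a1l; have a11 : a1 = 1 by nia.
  have xZ : x \notin Z by apply/negP => xZ; move: lt'; rewrite xZ; nia.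
  apply: ref_weaken (leqnn d) _ (cont x a2 xZ _ a2e); last first.
    by move: lt'; rewrite a11 (negbTE xZ); lia.
  by move=> z; rewrite a11 /G' !inE => /or3P[->|->|->]; rewrite ?orbT.
apply: (@ref_le _ _ ((u.+2 + Q + k.+1 * u).+1 + h * (3 * e + 12))); first by lia.
set G' := _ :: _.
have hY' : (ex (count nonstar) cY, true) \in G' by rewrite /G'; mem.
have hq : (ex (sum_tree h (fun i => count (fun x => incident i x))) q, true) \in G'.
  by rewrite /G'; mem.
apply: (sum_search mh cYe qe qe hY' hq hq (oP := fun=> 0) (oN := fun=> 0)
  (l1 := 0) (l2 := 1) (l3 := 0) (r1 := K) (r2 := 0) (r3 := 0)).
  by rewrite !big1 //; lia.
move=> i a1 a2 a3 _ a2e _ lt'.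
apply: (@ex_leaf _ _ _ (nonstar i) a1); first mem.
move=> a1l; case: (altP (a1 =P 1)) => a11; last first.
  apply: (@ref_le _ _ (1 + Q)); first by rewrite -addnA leq_add // leq_addr.
  apply: (@count_pick _ (fun x => incident i x) set0 a2) => //; first mem.
    by rewrite cards0; lia.
  move=> x _; apply: (@clash_andr _ _ _ _ (nonstar i) (witness i x) true); mem.
apply: (@witness_explicit i) => Z' G1 sub1 cZ' H.
apply: (@count_pick _ (fun x => incident i x) Z' a2) => //; first by apply: sub1; mem.
  by apply: leq_ltn_trans cZ' _; move: lt'; rewrite a11; lia.
move=> x xZ'; apply: (@and_query _ _ _ _ (nonstar i) (witness i x)); first mem.
apply: ref_weaken (leqnn u) _ (H x xZ') => w.
by rewrite !inE => /orP[->|->]; rewrite ?orbT.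
Qed.

Lemma extract (n' : nat) (f : 'I_n' -> form V) c b G d : n' <= 2 ^ h -> c < 2 ^ e ->
  (ex (count f) c, true) \in G -> b <= c ->
  (forall (J : {set 'I_n'}) G', {subset G <= G'} -> #|J| = b ->
    (forall z, z \in J -> (f z, true) \in G') -> ref s d G') ->
  ref s (d + b * Q) G.
Proof.
move=> nh' ce; elim: b G d => [|b IH] G d hc bc cont.
  rewrite addn0; apply: (cont set0) => //; first by rewrite cards0.
  by move=> z; rewrite inE.
rewrite mulSn addnA; apply: (IH G) => //; first exact: ltnW.
move=> J G' sub cJ hJ; apply: (count_pick (J := J) nh' ce (sub _ hc)); first by rewrite cJ.
move=> z zJ; apply: (cont (z |: J)).
- by move=> w /sub wG; rewrite inE wG orbT.
- by rewrite cardsU1 zJ cJ.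
by move=> w; rewrite !inE => /orP[/eqP ->|/hJ ->]; rewrite ?eqxx ?orbT.
Qed.

Lemma witnesses_explicit (cs : seq 'I_m) Z G d :
  (forall Z' G', {subset G <= G'} -> Z \subset Z' -> #|Z'| <= #|Z| + size cs * K ->
    (forall i y, i \in cs -> y \notin Z' -> ref s u ((witness i y, true) :: G')) ->
    ref s d G') -> ref s (d + size cs * (k.+1 * u)) G.
Proof.
elim: cs Z G => [|i cs IH] Z G cont.
  by rewrite addn0; apply: (cont Z) => //; rewrite addn0.
rewrite [size _]/= mulSn addnCA addnC; apply: (@witness_explicit i).
move=> Z0 G0 sub0 cZ0 H0; apply: (IH (Z :|: Z0)) => Z' G' sub ZZ' cZ' H.
apply: (cont Z').
- by move=> w /sub0/sub.
- by apply: subset_trans ZZ'; apply: subsetUl.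
- apply: leq_trans cZ' _; rewrite [size _]/= mulSn addnA leq_add2r.
  by apply: leq_trans (leq_card_setU _ _) _; rewrite leq_add2l.
move=> i' y; rewrite inE => /orP[/eqP ->|ics] yZ; last exact: H.
apply: ref_weaken (leqnn u) _ (H0 y _).
  by move=> w; rewrite !inE => /orP[->//|/sub ->]; rewrite orbT.
by apply: contraNN yZ => yZ0; apply: (subsetP ZZ'); rewrite inE yZ0 orbT.
Qed.

Lemma incident_intro d i x G : (nonstar i, true) \in G -> (witness i x, true) \in G ->
  ref s d ((incident i x, true) :: G) -> ref s d.+1 G.
Proof.
move=> h1 h2 cont; apply: (@ask _ _ (incident i x)) => //.
  by apply: bd_size (bd_incident i x) _; lia.
by apply: (@clash_and _ _ _ _ (nonstar i) (witness i x)); mem.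
Qed.

(** The vertices lost by one choice: the chosen vertex, and the witness sets, of at most [K]
    elements each, of the fewer than [2 * K] colours incident to it. *)
Let z1 := 1 + 2 * K * K.

(** No colour has both [x] and [y] in its witness set. This is not asked as a formula but stated as
    refutability in every larger context, so it survives all further queries. *)
Definition apart G x y := forall i G', {subset G <= G'} ->
  (nonstar i, true) \in G' -> (witness i x, true) \in G' -> (witness i y, true) \in G' ->
  ref s (2 * Q) G'.

Lemma apart_sub G G' x y : {subset G <= G'} -> apart G x y -> apart G' x y.
Proof. by move=> sub a i G2 sub2; apply: a => w /sub/sub2. Qed.

(** [Z] contains the chosen vertices together with the witness sets of all colours incident to them,
    so whatever lies outside [Z] is apart from every chosen vertex. The bound on [#|Z| + r * z1]
    leaves room for [r] more rounds of averaging. *)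
Lemma select r (xs : {set 'I_n}) Z cX cY G d : cX < 2 ^ e -> cY < 2 ^ e -> cY < cX ->
  2 * (#|Z| + r * z1) <= cY ->
  (ex (count kept) cX, true) \in G -> (ex (count nonstar) cY, true) \in G ->
  xs \subset Z -> (forall x, x \in xs -> (kept x, true) \in G) ->
  (forall x y, x \in xs -> y \notin Z -> apart G x y) ->
  (forall x y, x \in xs -> y \in xs -> x != y -> apart G x y) ->
  (forall (xs' : {set 'I_n}) G', {subset G <= G'} -> #|xs'| = #|xs| + r ->
     (forall x, x \in xs' -> (kept x, true) \in G') ->
     (forall x y, x \in xs' -> y \in xs' -> x != y -> apart G' x y) -> ref s d G') ->
  ref s (d + r * ((k + 7 + 2 * K * (k + 2)) * Q)) G.
Proof.
move=> cXe cYe lt; have uQ := u_le_Q.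
elim: r xs Z G => [|r IH] xs Z G cZ hX hY xsZ hk old pair cont.
  by rewrite addn0; apply: (cont xs) => //; rewrite addn0.
set C := _ * Q; rewrite [r.+1 * C]mulSn; set D := d + r * C.
apply: (@ref_le _ _ (D + 2 * K * (k.+1 * u) + 2 * K * Q + (k + 7) * Q)).
  have : 2 * K * (k.+1 * u) <= 2 * K * (k.+1 * Q) by rewrite !leq_mul2l uQ !orbT.
  by rewrite /D /C; lia.
apply: (low_degree (Z := Z) cXe cYe lt _ hX hY).
  by apply: leq_trans cZ; rewrite leq_mul2l leq_addr orbT.
move=> x c xZ cK ce.
apply: (@ref_le _ _ (D + c * (k.+1 * u) + c * Q)).
  by rewrite leq_add // ?leq_add2l leq_mul2r ltnW ?orbT.
apply: (extract mh ce (b := c)) => //; first mem.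
move=> J G1 sub1 cJ hJ.
have cJ' : size (enum J) = c by rewrite -cardE.
rewrite -{1}cJ'; apply: (witnesses_explicit (Z := x |: Z)) => Z' G2 sub2 ZZ' cZ' H.
have sub : {subset G <= G2} by move=> w wG; apply: sub2; apply: sub1; rewrite !inE wG !orbT.
have xZ' : x \in Z' by apply: (subsetP ZZ'); rewrite !inE eqxx.
have ZsubZ' : Z \subset Z' by apply: subset_trans ZZ'; apply: subsetUr.
(* A colour witnessed by [x] is either in [J], and then its witness set lies inside [Z'], or it
   would be one incident colour more than the exact count [c] allows. *)
have newx y : y \notin Z' -> apart G2 x y.
  move=> yZ' i G3 sub3 hi hx hy; case iJ: (i \in J).
    apply: (@ref_weaken _ _ u _ ((witness i y, true) :: G2)).
    - by apply: leq_trans uQ _; rewrite mul2n -addnn leq_addr.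
    - by move=> w; rewrite inE => /orP[/eqP ->|/sub3].
    by apply: H; rewrite ?mem_enum.
  apply: (@ref_le _ _ Q.+1).
    by rewrite mul2n -addnn -addn1 leq_add2l (leq_trans _ uQ) // addnS.
  apply: (incident_intro hi hx).
  apply: (@count_absurd _ (fun i => incident i x) (i |: J) c) => //.
  - by rewrite inE sub3 ?orbT //; apply: sub2; apply: sub1; mem.
  - by rewrite cardsU1 iJ cJ.
  move=> i'; rewrite !inE => /orP[/eqP ->|i'J]; first by rewrite eqxx.
  by rewrite sub3 ?orbT // sub2 // hJ.
have oldx y : y \in xs -> apart G2 y x by move=> yxs; apply: apart_sub sub (old y x yxs xZ).
have apart_sym y z : apart G2 y z -> apart G2 z y.
  by move=> a i G3 sub3 h1 h2 h3; apply: (a i).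
apply: (IH (x |: xs) Z').
- apply: leq_trans cZ; rewrite leq_mul2l mulSn addnA leq_add2r; apply/orP; right.
  apply: leq_trans cZ' _; rewrite cJ' cardsU1 xZ /z1.
  have cKK : c * K <= 2 * K * K by rewrite leq_mul2r ltnW ?orbT.
  by rewrite -addnA addnCA leq_add2l; apply: leq_add.
- exact: sub.
- exact: sub.
- by rewrite subUset sub1set xZ' (subset_trans xsZ).
- move=> y; rewrite !inE => /orP[/eqP ->|/hk/sub //].
  by apply: sub2; apply: sub1; rewrite mem_head.
- move=> y z; rewrite !inE => /orP[/eqP ->|yxs] zZ'; first exact: newx.
  by apply: apart_sub sub (old y z yxs _); apply: contraNN zZ' => /(subsetP ZsubZ').
- move=> y z; rewrite !inE => /orP[/eqP ->|yxs] /orP[/eqP ->|zxs] yz.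
  + by rewrite eqxx in yz.
  + exact/apart_sym/oldx.
  + exact: oldx.
  + exact: apart_sub sub (pair y z yxs zxs yz).
move=> xs' G3 sub3 cxs' hk' pair'; apply: (cont xs') => //.
  by move=> w /sub/sub3.
rewrite cxs' cardsU1; have -> : x \notin xs by apply: contraNN xZ => /(subsetP xsZ).
by lia.
Qed.

(** * Contradictions from a colouring without clashes *)

Variable G0 : seq (lit V).

Hypothesis colour_query : forall S d G, {subset G0 <= G} -> #|S| = k ->
  (forall i, ref s d ((has_colour S i, true) :: G)) -> ref s (d + 2 * u) G.

Hypothesis disjoint_absurd : forall S S' i G, {subset G0 <= G} -> #|S| = k -> #|S'| = k ->
  S :&: S' = set0 -> (has_colour S i, true) \in G -> (has_colour S' i, true) \in G ->
  ref s (2 * u) G.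

Lemma common_elt S S' i G d : {subset G0 <= G} -> #|S| = k -> #|S'| = k ->
  (has_colour S i, true) \in G -> (has_colour S' i, true) \in G -> 2 * u <= d ->
  (forall x, x \in S -> x \in S' -> ref s d G) -> ref s d G.
Proof.
move=> sub cS cS' hS hS' ud cont; case: (set_0Vmem (S :&: S')) => [d0|[x]].
  exact: ref_le ud (disjoint_absurd sub cS cS' d0 hS hS').
by rewrite inE => /andP[xS xS']; apply: cont xS xS'.
Qed.

(** The colour [i] of [xs] is not a star. The first set [A] of colour [i] meets [xs] in some [a],
    and the first set [B] of colour [i] avoiding [a] meets it in some [b]. Both lie in the witness
    set of [i] and they are different, so they are not apart. *)
Lemma independent_absurd (xs : {set 'I_n}) G : {subset G0 <= G} -> #|xs| = k ->
  (forall x, x \in xs -> (kept x, true) \in G) ->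
  (forall x y, x \in xs -> y \in xs -> x != y -> apart G x y) -> ref s (14 * Q) G.
Proof.
move=> sub cxs hk pair; have uQ := u_le_Q.
apply: (@ref_le _ _ (2 * Q + 12 * u)).
  by rewrite (mulnDl 2 12 Q) leq_add2l leq_mul2l uQ orbT.
have [Q' QE] : exists q, q = Q by eexists.
rewrite -QE in uQ *.
apply: (@ref_le _ _ (2 * Q' + 9 * u + u + 2 * u)); first lia.
apply: (colour_query sub cxs) => i.
apply: (colour_nonstar cxs (mem_head _ _)); first by move=> x /hk hx; mem.
have szM := size_members i.
apply: (@ref_le _ _ (2 * Q' + 8 * u + 3 * e + 9).+1); first lia.
apply: (@ask _ _ (big_or (members i))).
  by apply: (@bd_size 1) => //; apply: bd_or => //; apply: bd_members.
  2: {
  apply: (@or_intro _ _ _ e (members i) (has_colour xs i)) => //.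
  - mem.
  - by apply: map_f; rewrite ksets_card cxs.
  - mem.
  lia.
  }
apply: (@min_query _ _ _ e (members i)) => //; first mem.
  by move=> j _; apply: (@bd_size 3) => //; apply: bd_first_member.
rewrite size_map => j jl; set A := nth set0 ksets j.
apply: (@ref_le _ _ (2 * Q' + 7 * u).+1); first lia.
apply: (first_nth (mem_head _ _)); rewrite nth_members //.
set G1 := (X in ref _ _ X); have sub1 : {subset G <= G1} by move=> w wG; rewrite /G1; mem.
apply: (@common_elt xs A i G1) => //.
- by move=> w /sub/sub1.
- exact: ksets_nth.
- by rewrite /G1; mem.
- by rewrite /G1; mem.
- lia.
move=> a axs aA.
apply: (@ref_le _ _ (2 * Q' + 5 * u + 2 * u)); first lia.
apply: (@bad_of_nonstar _ _ i a); first by rewrite /G1; mem.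
have szL := size_members_avoiding i a.
apply: (@ref_le _ _ (2 * Q' + 4 * u + 3 * e + 9)); first lia.
apply: (@min_query _ _ _ e (members_avoiding i a)) => //; first mem.
  by move=> j' _; apply: (@bd_size 3) => //; apply: bd_first_avoiding.
rewrite size_map => j' jl'; set B := nth set0 (avoid a) j'.
apply: (@ref_le _ _ (2 * Q' + 3 * u).+1); first lia.
apply: (first_nth (mem_head _ _)); rewrite nth_members_avoiding //.
set G2 := (X in ref _ _ X); have sub2 : {subset G1 <= G2} by move=> w wG; rewrite /G2; mem.
apply: (@common_elt xs B i G2) => //.
- by move=> w /sub/sub1/sub2.
- exact: avoid_card.
- by apply: sub2; rewrite /G1; mem.
- by rewrite /G2; mem.
- lia.
move=> b bxs bB.
have ab : a != b by apply: contraTneq bB => <-; apply: avoid_notin.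
have hi : (nonstar i, true) \in G1 by rewrite /G1; mem.
have f1 : (first (members i) j, true) \in G2 by apply: sub2; rewrite /G1; mem.
have f2 : (first (members_avoiding i a) j', true) \in G2 by rewrite /G2; mem.
apply: (@ref_le _ _ (2 * Q' + u).+2); first lia.
apply: (@ask _ _ (witness i a)); first by apply: bd_size (bd_witness i a) _; lia.
  apply: (@ask _ _ (witness i b)); first by apply: bd_size (bd_witness i b) _; lia.
    apply: (@ref_le _ _ (2 * Q')); first lia.
    rewrite QE; apply: (pair a b axs bxs ab i); try mem.
      by move=> w /sub1/sub2 wG; mem.
  set C := And (first (members i) j) (first (members_avoiding i a) j').
  apply: (@ref_le _ _ (e + 1).+1); first lia.
  apply: (@ask _ _ C).
  - by apply: (@bd_size 4) => //; apply: bd_and; [apply: bd_first_member|apply: bd_first_avoiding].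
  - apply: (@or_intro _ _ _ e (witness_list i b) C).
    + exact: size_witness_list.
    + by rewrite -/(witness i b); mem.
    + rewrite mem_cat; apply/orP; right; apply/mapP; exists (j, a, j') => //.
      rewrite mem_filter /= aA jl' bB /=; apply/allpairsP; exists ((j, a), j').
      split=> //=; last first.
        by rewrite mem_iota /=; apply: leq_trans jl' _; rewrite size_filter count_size.
      by apply/allpairsP; exists (j, a); rewrite /= mem_iota mem_enum.
    + mem.
    by rewrite addn1.
  by apply: (@clash_and _ _ _ _ (first (members i) j) (first (members_avoiding i a) j')); mem.
apply: (@or_intro _ _ _ e (witness_list i a) (first (members i) j)).
- exact: size_witness_list.
- by rewrite -/(witness i a); mem.
- rewrite mem_cat; apply/orP; left; apply/mapP; exists j => //.
  by rewrite mem_filter mem_iota aA.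
- mem.
lia.
Qed.

(** The answers are collected in an actual function [col], with [i0] as value before any query. A
    colour outside [ys] would not be a star, and would be one too many for the exact count [cY]. *)
Lemma colour_all (ys : {set 'I_m}) (i0 : 'I_m) cY (xs : {set 'I_n}) (ss : seq {set 'I_n}) G d :
  {subset G0 <= G} -> cY < 2 ^ e -> (ex (count nonstar) cY, true) \in G -> #|ys| = cY ->
  (forall i, i \in ys -> (nonstar i, true) \in G) ->
  (forall x, x \in xs -> (kept x, true) \in G) ->
  (forall S, S \in ss -> S \subset xs /\ #|S| = k) ->
  (forall (col : {set 'I_n} -> 'I_m) G', {subset G <= G'} ->
     (forall S, S \in ss -> (has_colour S (col S), true) \in G' /\ col S \in ys) ->
     ref s d G') ->
  ref s (d + size ss * (4 * Q)) G.
Proof.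
move=> sub cYe hY cys hys hxs; have uQ := u_le_Q; elim: ss d => [|S ss IH] d hss cont.
  by rewrite addn0; apply: (cont (fun=> i0)).
rewrite [size _]/= mulSn addnA; apply: IH => [S' S'ss|col G' sub' hcol].
  by apply: hss; rewrite inE S'ss orbT.
have [Sxs cS] := hss S (mem_head _ _).
apply: (@ref_le _ _ (d + Q + u + 2 * u)).
  have : d + Q + u + 2 * u = d + (Q + 3 * u) by lia.
  move=> ->; rewrite leq_add2l (mulnDl 1 3 Q) mul1n leq_add2l leq_mul2l uQ orbT //.
apply: (colour_query _ cS) => [w /sub/sub' //|i].
apply: (colour_nonstar cS (mem_head _ _)).
  by move=> x /(subsetP Sxs)/hxs/sub' hx; mem.
case iys: (i \in ys); last first.
  apply: (@ref_le _ _ Q); first by rewrite leq_addl.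
  apply: (@count_absurd _ nonstar (i |: ys) cY) => //.
  - by rewrite 2!in_cons sub' ?orbT.
  - by rewrite cardsU1 iys cys.
  move=> i'; rewrite !inE => /orP[/eqP ->|/hys/sub' ->]; rewrite ?eqxx ?orbT //.
apply: (@ref_le _ _ d); first by rewrite leq_addr.
apply: (cont (fun S' => if S' == S then i else col S')).
  by move=> w /sub' wG; mem.
move=> S'; rewrite inE /=; case: eqP => [-> _|_ /= /hcol[hc cc]]; split=> //; mem.
Qed.

(** The number of remaining colours from which k rounds of the greedy choice are possible, starting
    with nothing excluded. *)
Let N0 := 2 * (k * z1).

(** All [cY] remaining colours and exactly [cY + 2 * k - 1] kept vertices are named. These vertices
    have at most [2 ^ (N0 + 2 * k)] subsets of size k, a number bounded in terms of k, so all their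
    colours can be queried. *)
Lemma small_absurd (i0 : 'I_m) cX cY G : {subset G0 <= G} -> cX < 2 ^ e -> cY < 2 ^ e ->
  (ex (count kept) cX, true) \in G -> (ex (count nonstar) cY, true) \in G ->
  cY + 2 * k - 1 <= cX -> cY <= N0 ->
  ref s ((2 * N0 + 2 * k + 4 * 2 ^ (N0 + 2 * k) + 2) * Q) G.
Proof.
move=> sub cXe cYe hX hY XY YN; have uQ := u_le_Q; set b := cY + 2 * k - 1 in XY.
have bN : b <= N0 + 2 * k by apply: leq_trans (leq_subr _ _) _; rewrite leq_add2r.
pose T := 2 ^ (N0 + 2 * k) * (4 * Q).
apply: (@ref_le _ _ (2 * u + T + cY * Q + b * Q)).
  apply: (@leq_trans (2 * Q + T + N0 * Q + (N0 + 2 * k) * Q)).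
    apply: leq_add; last by rewrite leq_mul2r bN orbT.
    apply: leq_add; last by rewrite leq_mul2r YN orbT.
    by rewrite leq_add2r leq_mul2l uQ orbT.
  by rewrite /T; move: (N0) (2 ^ _) (Q) => a c q; lia.
apply: (extract nh cXe hX XY) => xs G1 sub1 cxs hxs.
apply: (extract mh cYe (sub1 _ hY) (leqnn cY)) => ys G2 sub2 cys hys.
pose ss := enum [set S : {set 'I_n} | (S \subset xs) && (#|S| == k)].
apply: (@ref_le _ _ (2 * u + size ss * (4 * Q))).
  rewrite leq_add2l leq_mul2r; apply/orP; right; rewrite -cardE.
  apply: (@leq_trans #|powerset xs|).
    by apply: subset_leq_card; apply/subsetP => S; rewrite !inE => /andP[].
  by rewrite card_powerset leq_pexp2l // cxs.
apply: (@colour_all ys i0 cY xs) => //.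
- by move=> w /sub/sub1/sub2.
- by apply: sub2; apply: sub1.
- by move=> x /hxs/sub2.
- by move=> S; rewrite mem_enum inE => /andP[-> /eqP].
move=> col G3 sub3 hcol.
have [||S [S' [[Sxs Sxs' cS cS'] [d0 e0]]]] := @kneser_monochromatic _ _ xs k (enum ys) col k0.
- by rewrite -cardE cxs cys.
- move=> S Sxs cS; rewrite mem_enum; have [|_ ->//] := hcol S.
  by rewrite mem_enum inE Sxs cS eqxx.
have inss S0 : S0 \subset xs -> #|S0| = k -> S0 \in ss.
  by move=> h1 h2; rewrite mem_enum inE h1 h2 eqxx.
apply: (disjoint_absurd (S := S) (S' := S') (i := col S)) => //.
- by move=> w /sub/sub1/sub2/sub3.
- by have [] := hcol S (inss _ Sxs cS).
by rewrite e0; have [] := hcol S' (inss _ Sxs' cS').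
Qed.

Definition cost := 22 + k * (k + 7 + 2 * K * (k + 2)) +
  (2 * N0 + 2 * k + 4 * 2 ^ (N0 + 2 * k) + 2).

Lemma kneser_ref (i0 : 'I_m) G : m + 2 * k = n + 1 -> {subset G0 <= G} -> ref s (cost * Q) G.
Proof.
move=> nE sub; have uQ := u_le_Q; have Q0 : 0 < Q by apply: leq_trans uQ; rewrite addnS.
pose c1 := k * (k + 7 + 2 * K * (k + 2)).
pose c2 := 2 * N0 + 2 * k + 4 * 2 ^ (N0 + 2 * k) + 2.
have costE : cost = 22 + c1 + c2 by [].
apply: (@ref_le _ _ ((20 + c1 + c2) * Q + Q + Q)).
  by rewrite costE; move: (c1) (c2) (Q) => a b q; lia.
apply: (@count_query _ kept) => [x|cX cXe]; first exact: bd8_kept.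
apply: (@count_query _ nonstar) => [i|cY cYe]; first exact: bd8_nonstar.
set G1 := _ :: _; have sub1 : {subset G <= G1} by move=> w wG; rewrite /G1; mem.
have hX : (ex (count kept) cX, true) \in G1 by rewrite /G1; mem.
have hY : (ex (count nonstar) cY, true) \in G1 by rewrite /G1; mem.
(* Once [balance] has excluded the first case, [cX] is at least [cY + (n - m)], and [n - m] equals
   2k - 1. *)
case: (ltnP (cX + m) (cY + n)) => XY.
  apply: (@ref_le _ _ (6 * Q)); first by rewrite leq_mul2r; lia.
  exact: (balance cXe cYe XY hX hY).
case: (leqP N0 cY) => NY.
  apply: (@ref_le _ _ (14 * Q + k * ((k + 7 + 2 * K * (k + 2)) * Q))).
    rewrite [k * _]mulnA -/c1 -mulnDl leq_mul2r; lia.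
  apply: (@select k set0 set0 cX cY G1) => //; rewrite ?cards0 ?add0n ?sub0set //; try lia.
  - by move=> x; rewrite inE.
  - by move=> x y; rewrite inE.
  - by move=> x y; rewrite inE.
  move=> xs G' sub' cxs hk pair; apply: (@independent_absurd xs) => //.
    by move=> w /sub/sub1/sub'.
apply: (@ref_le _ _ (c2 * Q)); first by rewrite leq_mul2r; lia.
apply: (@small_absurd i0 cX cY) => //; [by move=> w /sub/sub1|lia|exact: ltnW].
Qed.

End Strategy.

(** * Kneser's formulas *)

Lemma bd_and_list (V : eqType) e r (l : seq (form V)) : size l <= 2 ^ e ->
  {in l, forall f, bd e r f} -> bd e r.+1 (big_and l).
Proof.
move=> le lb.
have szl : form_size (big_and l) <= size l * (2 ^ ((e + 2) * r)).+1 + 1.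
  elim: l lb {le} => // f l IH lb.
  have fb : form_size f <= 2 ^ ((e + 2) * r) by apply: lb; rewrite mem_head.
  have {}IH : form_size (big_and l) <= size l * (2 ^ ((e + 2) * r)).+1 + 1.
    by apply: IH => g gl; apply: lb; rewrite inE gl orbT.
  rewrite -[size (f :: l)]/(size l).+1 mulSn; move: (size l * _) IH => z.
  by case: l {lb} => [|g l] IH; rewrite big_and_cons ?size_and; lia.
rewrite /bd -bd_step; apply: leq_trans szl _.
set q := 2 ^ e in le *; set z := 2 ^ _; have z0 : 0 < z by rewrite expn_gt0.
have q0 : 0 < q by rewrite expn_gt0.
apply: (@leq_trans (q * z.+1 + 1)); first by rewrite leq_add2r leq_mul2r le orbT.
nia.
Qed.

Section Kneser.

Variables n k h e : nat.
Let m := n - 2 * k + 1.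
Local Notation V := ({set 'I_n} * 'I_m)%type.
Let s := 2 ^ ((e + 2) * (11 + 4 * h)).

Hypothesis k0 : 0 < k.
Hypothesis kn : 2 * k <= n.
Hypothesis nh : n <= 2 ^ h.
Hypothesis he : 2 * h < e.
Hypothesis ke : 'C(n, k) * n * 'C(n, k) + 'C(n, k) <= 2 ^ e.

Let Ks := [set A : {set 'I_n} | #|A| == k].
Let pairs := [set AB : {set 'I_n} * {set 'I_n} |
                [&& #|AB.1| == k, #|AB.2| == k & AB.1 :&: AB.2 == set0]].

Definition some_colour (A : {set 'I_n}) : form V := big_or [seq Var (A, i) | i <- enum 'I_m].
Definition clash_colour (AB : {set 'I_n} * {set 'I_n}) : form V :=
  big_or [seq And (Var (AB.1, i)) (Var (AB.2, i)) | i <- enum 'I_m].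
Definition coloured : form V := big_and [seq some_colour A | A <- enum Ks].
Definition clashing : form V := big_or [seq clash_colour AB | AB <- enum pairs].

Lemma kneserE : kneser n k = Imp coloured clashing.
Proof. by []. Qed.

Lemma card_Ks : #|Ks| = 'C(n, k).
Proof. by rewrite card_draws card_ord. Qed.

Lemma size_Ks : size (enum Ks) <= 2 ^ e.
Proof. by rewrite -cardE card_Ks (leq_trans _ ke) // leq_addl. Qed.

Lemma n_gt0 : 0 < n.
Proof. by apply: leq_trans kn; rewrite muln_gt0. Qed.

Lemma size_pairs : size (enum pairs) <= 2 ^ e.
Proof.
rewrite -cardE; apply: (@leq_trans #|setX Ks Ks|).
  by apply: subset_leq_card; apply/subsetP => -[A B]; rewrite !inE => /and3P[/= -> ->].
rewrite cardsX card_Ks (leq_trans _ ke) // -mulnA mulnCA -[X in X <= _]mul1n.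
by apply: leq_trans (leq_addr _ _); rewrite leq_mul2r n_gt0 orbT.
Qed.

Lemma m_le_n : m <= n.
Proof. by rewrite /m; have := k0; have := kn; lia. Qed.

Lemma size_colours : size (enum 'I_m) <= 2 ^ e.
Proof.
rewrite size_enum_ord (leq_trans m_le_n) // (leq_trans nh) // leq_pexp2l //.
by have := he; lia.
Qed.

Lemma bd_some_colour A : bd e 1 (some_colour A).
Proof.
by apply: bd_or => [|f /mapP[i _ ->]]; [rewrite size_map size_colours|apply: bd_const].
Qed.

Lemma bd_clash_colour AB : bd e 2 (clash_colour AB).
Proof.
apply: bd_or => [|f /mapP[i _ ->]]; first by rewrite size_map size_colours.
by apply: bd_and; apply: bd_const.
Qed.

Lemma bd_kneser : bd e 4 (kneser n k).
Proof.
rewrite kneserE -[bd e 4 _]/(bd e 4 (And coloured clashing)); apply: bd_and.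
  apply: (@bd_le _ _ 2) => //; apply: bd_and_list; first by rewrite size_map size_Ks.
  by move=> f /mapP[A _ ->]; apply: bd_some_colour.
apply: bd_or; first by rewrite size_map size_pairs.
by move=> f /mapP[AB _ ->]; apply: bd_clash_colour.
Qed.

Lemma kneser_size : form_size (kneser n k) <= s.
Proof. by apply: leq_trans bd_kneser _; rewrite leq_pexp2l // leq_mul2l; lia. Qed.

Lemma kneser_refutation :
  refutation s (cost k * ((h + 1) * (7 * h + 11) * (4 * e + 12)) + 2) [:: (kneser n k, false)].
Proof.
have m0 : 0 < m by rewrite /m addn1.
have mh : m <= 2 ^ h := leq_trans m_le_n nh.
pose G0 : seq (lit V) := [:: (coloured, true); (clashing, false)].
suff r : ref s (cost k * ((h + 1) * (7 * h + 11) * (4 * e + 12)) + 2) [:: (kneser n k, false)].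
  by apply: r => l; rewrite inE => /eqP ->; apply: kneser_size.
rewrite addn2; apply: (@imp_query _ _ _ _ coloured clashing); first by rewrite mem_head.
have szk : size (ksets n k) = 'C(n, k) by rewrite /ksets -lock -cardE card_Ks.
apply: (@kneser_ref n m k h e k0 nh mh he _ G0) => //.
- by rewrite szk.
- move=> S d G sub Sk cont; apply: (@ref_le _ _ (d + e + 2 + e + 2)); first lia.
  apply: (@and_true _ _ _ e [seq some_colour A | A <- enum Ks] (some_colour S)).
  + by rewrite size_map size_Ks.
  + by apply: sub; rewrite mem_head.
  + by apply: map_f; rewrite mem_enum inE Sk.
  apply: (@or_query _ _ _ e [seq Var (S, i) | i <- enum 'I_m]).
  + by rewrite size_map size_colours.
  + by rewrite mem_head.
  move=> f /mapP[i _ ->]; apply: ref_weaken (leqnn d) _ (cont i) => l.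
  by rewrite !inE => /orP[->|->]; rewrite ?orbT.
- move=> S S' i G sub Sk Sk' d0 hS hS'; apply: (@ref_le _ _ (0 + e + 2 + e + 2)); first lia.
  apply: (@or_false _ _ _ e [seq clash_colour AB | AB <- enum pairs] (clash_colour (S, S'))).
  + by rewrite size_map size_pairs.
  + by apply: sub; rewrite !inE eqxx orbT.
  + by apply: map_f; rewrite mem_enum inE /= Sk Sk' d0 !eqxx.
  apply: (@or_false _ _ _ e [seq And (Var (S, i)) (Var (S', i)) | i <- enum 'I_m]
    (And (Var (S, i)) (Var (S', i)))).
  + by rewrite size_map size_colours.
  + by rewrite mem_head.
  + by apply/mapP; exists i; rewrite ?mem_enum.
  apply: (@clash_and _ _ _ _ (Var (S, i)) (Var (S', i))); first by rewrite mem_head.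
    by do 2 (rewrite in_cons; apply/orP; right).
  by do 2 (rewrite in_cons; apply/orP; right).
- exact: Ordinal m0.
- by rewrite /m; lia.
by move=> l; rewrite !inE => /orP[->|->]; rewrite ?orbT.
Qed.

End Kneser.

Lemma bin_le_exp n k : 'C(n, k) <= n ^ k.
Proof.
have ffact_le : n ^_ k <= n ^ k.
  elim: k n => [|k IH] [|n] //; rewrite ffactnS expnS leq_mul //.
  by apply: leq_trans (IH n) _; case: k {IH} => // k; rewrite leq_exp2r.
by apply: leq_trans ffact_le; rewrite -bin_ffact leq_pmulr // fact_gt0.
Qed.

Theorem theorem5 (R : seq rule) (hR : frege_system R) (k : nat) (hk : 1 <= k) :
  exists C : nat, forall n : nat, 2 * k <= n ->
    exists p : seq (form ({set 'I_n} * 'I_(n - 2 * k + 1))),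
      proof_of R [::] (kneser n k) p /\
      proof_size p <= 2 ^ (C * trunc_log 2 n ^ C).
Proof.
have [c cP] := refutation_proof hR.
(* With [d] the depth and [2 ^ E] the formula size, the proof has size at most 2^(c + 3d + E + 13).
   The summand [+ 2] in [d] raises 13 to 19; 225 is 3 times the 3 and 25 that bound [h + 1] and
   [7 * h + 11] by multiples of [L]. *)
pose a := c + 19 + 225 * cost k * (16 * k + 24) + 19 * (4 * k + 5).
(* The depth is of order [L ^ 3] and [E] of order [L ^ 2], so [a * L ^ 3] bounds the exponent;
   [a + 3] serves both as factor and as power, since [L] is positive. *)
exists (a + 3) => n kn; set L := trunc_log 2 n.
have L0 : 0 < L by rewrite trunc_log_gt0 /=; lia.
have [h hE] : exists h, h = L + 1 by eexists.
(* The longest list has a triple of two k-sets and a vertex for each entry, at most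
   [2 ^ ((2 * k + 1) * h)] in number; the extra 1 makes room for the additional 'C(n, k) entries. *)
have [e eE] : exists e, e = (2 * k + 1) * h + 1 by eexists.
have nh : n <= 2 ^ h by rewrite hE addn1 ltnW // trunc_log_ltn.
have he : 2 * h < e by rewrite eE; nia.
have ke : 'C(n, k) * n * 'C(n, k) + 'C(n, k) <= 2 ^ e.
  have Ck : 'C(n, k) <= 2 ^ (h * k).
    apply: leq_trans (bin_le_exp n k) _; rewrite expnM leq_exp2r //.
  have C1 : 'C(n, k) * n * 'C(n, k) <= 2 ^ ((2 * k + 1) * h).
    have -> : (2 * k + 1) * h = h * k + h + h * k by lia.
    by rewrite !expnD; apply: leq_mul => //; apply: leq_mul.
  rewrite eE addn1 expnS mul2n -addnn leq_add // (leq_trans Ck) // leq_pexp2l //; nia.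
have [p [pP pS]] := cP _ _ _ _ (kneser_refutation hk kn nh he ke) (kneser_size hk kn nh he ke).
exists p; split=> //; apply: leq_trans pS _.
set d := cost k * _ + 2; set E := (e + 2) * (11 + 4 * h).
have sq x : x <= 2 ^ x by apply: ltnW; apply: ltn_expl.
have step : c * (2 ^ d.+1 * (d + 5) ^ 2 * (2 ^ E + 2)) <= 2 ^ (c + (d.+1 + (d + 5) * 2 + E.+2)).
  rewrite expnD leq_mul // expnD leq_mul //.
    by rewrite expnD leq_mul // expnM leq_exp2r.
  by have := expn_gt0 2 E; rewrite !expnS; lia.
apply: leq_trans step _; rewrite leq_pexp2l //.
apply: (@leq_trans (a * L ^ 3)); last first.
  by rewrite leq_mul ?leq_addr // leq_pexp2l // leq_addl.
have h1 : h + 1 <= 3 * L by rewrite hE; lia.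
have h2 : 7 * h + 11 <= 25 * L by rewrite hE; lia.
have e1 : e + 2 <= (4 * k + 5) * L by rewrite eE hE; nia.
have e2 : 4 * e + 12 <= (16 * k + 24) * L by rewrite eE hE; nia.
have h3 : 11 + 4 * h <= 19 * L by rewrite hE; lia.
have dE : d <= cost k * (3 * L * (25 * L) * ((16 * k + 24) * L)) + 2.
  by rewrite leq_add2r leq_mul2l !leq_mul ?orbT.
have EE : E <= (4 * k + 5) * L * (19 * L) by rewrite leq_mul.
have L1 : 1 <= L ^ 3 by rewrite expn_gt0 L0.
have L2 : L * L <= L ^ 3 by rewrite !expnS expn0 muln1 mulnA leq_pmulr.
have d3 : 3 * d <= 225 * cost k * (16 * k + 24) * L ^ 3 + 6.
  apply: leq_trans (leq_mul (leqnn 3) dE) _; rewrite !expnS expn0; lia.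
have E3 : E <= 19 * (4 * k + 5) * L ^ 3.
  apply: leq_trans EE _; apply: (@leq_trans (19 * (4 * k + 5) * (L * L))); first lia.
  by rewrite leq_mul2l L2 orbT.
have c3 : c + 19 <= (c + 19) * L ^ 3 by rewrite leq_pmulr.
have aE : a * L ^ 3 = (c + 19) * L ^ 3 + 225 * cost k * (16 * k + 24) * L ^ 3
    + 19 * (4 * k + 5) * L ^ 3 by rewrite /a; lia.
rewrite aE; move: d3 E3 c3.
move: (225 * _ * _ * _) (19 * _ * _) ((c + 19) * _) => u v w; lia.
Qed.
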